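(* Let $M$ be a parallelizable smooth manifold of dimension $m\ge 3$ and let $\Pi\in\Gamma(\wedge^m TM)$ be an $m$-vector field on $M$ which is non-vanishing (i.e. not identically zero). Let $\mathcal A=\wedge^{m-1}T^*M$ be the Lie algebroid associated with $\Pi$. Then the modular class of the Lie algebroid $\mathcal A$ (in the sense of Evens–Lu–Weinstein) is $m$ times the modular class of the Nambu–Poisson manifold $(M,\Pi)$, both being considered as elements of the first Lie algebroid cohomology (with trivial coefficients) of $\mathcal A=\wedge^{m-1}T^*M$.
   Context: **Contractions.** Multisections are evaluated by $P(\alpha_1\wedge\cdots\wedge\alpha_k)=P(\alpha_1,\dots,\alpha_k)$, with $(X_1\wedge\cdots\wedge X_k)(\alpha_1,\dots,\alpha_k)=\det(\alpha_i(X_j))$. For a $1$-form $\alpha$, $(\iota_\alpha P)(\beta)=P(\alpha\wedge\beta)$, and $\iota_{\alpha_1\wedge\cdots\wedge\alpha_k}=\iota_{\alpha_k}\circ\cdots\circ\iota_{\alpha_1}$. Put $\Pi^\sharp:\wedge^{m-1}T^*M\to TM$, $\Pi^\sharp\alpha=\iota_\alpha\Pi$. $\mathcal L$ is the Lie derivative. **The Lie algebroid $\mathcal A$.** Every $m$-vector field $\Pi$ on $M$ ($m=\dim M\ge 3$) is a Nambu–Poisson tensor of order $m$. The bundle $\mathcal A=\wedge^{m-1}T^*M$ with bracket $[\alpha,\beta]=\mathcal L_{\Pi^\sharp\alpha}\beta+(-1)^m(\iota_{d\alpha}\Pi)\beta$ on sections and anchor $\Pi^\sharp$ is a Lie algebroid.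 **Modular class of $(M,\Pi)$.** For a volume form $\eta$ on $M$, the modular tensor field $M^\eta\in\Gamma(\wedge^{m-1}TM)$ is defined by $(\iota_\alpha M^\eta)\eta=\mathcal L_{\Pi^\sharp\alpha}\eta+(-1)^m(\iota_{d\alpha}\Pi)\eta$ for all $\alpha\in\Omega^{m-1}(M)$; equivalently $\mathcal L_{\Pi^\sharp(df_1\wedge\cdots\wedge df_{m-1})}\eta=M^\eta(df_1,\dots,df_{m-1})\,\eta$ for all functions $f_i$. The $C^\infty(M)$-linear map $\alpha\mapsto\iota_\alpha M^\eta$ is a $1$-cocycle of the Lie algebroid $\mathcal A$ with trivial coefficients; its class in the first Lie algebroid cohomology of $\mathcal A$ is independent of $\eta$ and is the modular class of $(M,\Pi)$. **Evens–Lu–Weinstein modular class.** Let $A$ be a Lie algebroid over $M$ with anchor $\rho$, and $\nabla$ a representation of $A$ (flat $A$-connection) on a line bundle $L$. If $L$ is trivial with nowhere vanishing section $s$, define $\theta_s\in\Gamma A^*$ by $\nabla_a s=\langle\theta_s,a\rangle s$; the class of $\theta_s$ in the first Lie algebroid cohomology of $A$ does not depend on $s$ and is the characteristic class of $(A,L)$. If $L$ is non-trivial, the characteristic class is one half of that of $L\otimes L$. The modular class of $A$ is the characteristic class for $Q_A=\wedge^{\mathrm{top}}A\otimes\wedge^{\mathrm{top}}T^*M$ with representation $\nabla_a(X\otimes\nu)=[a,X]\otimes\nu+X\otimes\mathcal L_{\rho(a)}\nu$, where $[\cdot,\cdot]$ is the Gerstenhaber (Schouten) bracket on multisections of $A$.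 *)

(* Defs.v *)
From HB Require Import structures.
From mathcomp Require Import all_boot all_order all_algebra perm.
From mathcomp Require Import generic_quotient ring_quotient.
From mathcomp Require Import boolp classical_sets functions reals topology.
From mathcomp Require Import normedtype derive ring zify.

Set Implicit Arguments.
Unset Strict Implicit.
Unset Printing Implicit Defensive.

Import Order.TTheory GRing.Theory Num.Theory numFieldNormedType.Exports.
Local Open Scope classical_set_scope.
Local Open Scope ring_scope.

Section SmoothOn.
Variables (R : realType) (m : nat).
Implicit Types (U : set 'rV[R]_m) (f g : 'rV[R]_m -> R).

(* For [U] open: the partial derivatives of [f] of order at most [k] exist and
   are continuous on [U]; the values of [f] outside [U] are irrelevant. *)
Fixpoint Ck (k : nat) U f : Prop :=
  match k with
  | 0 => forall x, U x -> {for x, continuous f}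
  | k'.+1 => [/\ forall x, U x -> {for x, continuous f},
                 forall x i, U x -> derivable f x (delta_mx 0 i)
               & forall i, Ck k' U ('D_(delta_mx 0 i) f)]
  end.

Definition smooth_on U f : Prop := forall k, Ck k U f.

Lemma Ck_cont k U f : Ck k U f -> forall x, U x -> {for x, continuous f}.
Proof. by case: k => [|k] // []. Qed.

Lemma CkW k U f : Ck k.+1 U f -> Ck k U f.
Proof.
elim: k f => [f [] //|k IH f [cf df Df]].
by split=> // i; apply: IH; exact: Df.
Qed.

Lemma eq_Ck k U f g : open U -> (forall x, U x -> f x = g x) ->
  Ck k U f -> Ck k U g.
Proof.
move=> oU; have nfg (f' g' : 'rV[R]_m -> R) :
    (forall x, U x -> f' x = g' x) -> forall x, U x ->
    \forall y \near x, f' y = g' y.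
  move=> fg x Ux; near=> y; apply: fg; near: y.
  exact: open_nbhs_nbhs.
have cfg (f' g' : 'rV[R]_m -> R) : (forall x, U x -> f' x = g' x) ->
    (forall x, U x -> {for x, continuous f'}) ->
    (forall x, U x -> {for x, continuous g'}).
  move=> fg cf x Ux; rewrite /prop_for /continuous_at -fg//.
  by apply: cvg_trans (cf x Ux); apply: near_eq_cvg (nfg _ _ fg x Ux).
elim: k f g => [f g fg|k IH f g fg] /=; first exact: cfg.
move=> [cf df Df]; split; first exact: cfg cf.
- by move=> x i Ux; apply: near_eq_derivable (df x i Ux); exact: nfg.
- move=> i; apply: IH (Df i) => x Ux; apply: near_eq_derive.
  exact: nfg.
Unshelve. all: by end_near.
Qed.

Lemma Ck_cst k U (c : R) : Ck k U (cst c).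
Proof.
elim: k c => [|k IH] c /=; first by move=> x _; exact: cst_continuous.
split; [by move=> x _; exact: cst_continuous|by []|move=> i].
rewrite (_ : 'D__ _ = cst 0); first exact: IH.
by apply/funext => x; rewrite derive_cst.
Qed.

Lemma CkD k U f g : open U -> Ck k U f -> Ck k U g -> Ck k U (f + g).
Proof.
move=> oU; elim: k f g => [f g cf cg|k IH f g [cf df Df] [cg dg Dg]] /=.
  by move=> x Ux; exact: continuousD (cf x Ux) (cg x Ux).
split.
- by move=> x Ux; exact: continuousD (cf x Ux) (cg x Ux).
- by move=> x i Ux; exact: derivableD (df x i Ux) (dg x i Ux).
- move=> i; apply: (eq_Ck oU) (IH _ _ (Df i) (Dg i)) => x Ux.
  by rewrite deriveD//; [exact: df|exact: dg].
Qed.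

Lemma CkN k U f : open U -> Ck k U f -> Ck k U (- f).
Proof.
move=> oU; elim: k f => [f cf|k IH f [cf df Df]] /=.
  by move=> x Ux; exact: continuousN (cf x Ux).
split.
- by move=> x Ux; exact: continuousN (cf x Ux).
- by move=> x i Ux; exact: derivableN (df x i Ux).
- move=> i; apply: (eq_Ck oU) (IH _ (Df i)) => x Ux.
  by rewrite deriveN//; exact: df.
Qed.

Lemma CkM k U f g : open U -> Ck k U f -> Ck k U g -> Ck k U (f * g).
Proof.
move=> oU; elim: k f g => [f g cf cg|k IH f g Cf Cg] /=.
  by move=> x Ux; exact: continuousM (cf x Ux) (cg x Ux).
have [cf df Df] := Cf; have [cg dg Dg] := Cg; split.
- by move=> x Ux; exact: continuousM (cf x Ux) (cg x Ux).
- by move=> x i Ux; exact: derivableM (df x i Ux) (dg x i Ux).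
- move=> i; apply: (eq_Ck oU) (CkD oU (IH _ _ (CkW Cf) (Dg i))
                                      (IH _ _ (CkW Cg) (Df i))) => x Ux.
  by rewrite deriveM//; [exact: df|exact: dg].
Qed.

End SmoothOn.

(* A second countable Hausdorff space with a smooth atlas; [chart_inv i] is only
   meaningful on the image of the chart [chart i]. *)
Record smoothManifold (R : realType) (m : nat) := SmoothManifold {
  carrier :> topologicalType;
  manifold_hausdorff : hausdorff_space carrier;
  manifold_second_countable : @second_countable carrier;
  chart_index : Type;
  chart_dom : chart_index -> set carrier;
  chart : chart_index -> carrier -> 'rV[R]_m;
  chart_inv : chart_index -> 'rV[R]_m -> carrier;
  chart_dom_open : forall i, open (chart_dom i);
  chart_im_open : forall i, open (chart i @` chart_dom i);
  chart_cover : forall p, exists i, chart_dom i p;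
  chartK : forall i p, chart_dom i p -> chart_inv i (chart i p) = p;
  chart_continuous : forall i p,
    chart_dom i p -> {for p, continuous (chart i)};
  chart_inv_continuous : forall i x,
    (chart i @` chart_dom i) x -> {for x, continuous (chart_inv i)};
  chart_transition : forall i j (l : 'I_m),
    smooth_on (chart i @` (chart_dom i `&` chart_dom j))
      (fun x => chart j (chart_inv i x) 0 l)
}.

Section SmoothFunctions.
Variables (R : realType) (m : nat) (M : smoothManifold R m).

Definition smooth : {pred M -> R} := fun f =>
  `[< forall i, smooth_on (chart i @` chart_dom i) (f \o @chart_inv _ _ M i) >].

Lemma smooth_subring : subring_closed smooth.
Proof.
split.
- by apply/asboolP => i k; exact: (@Ck_cst _ _ _ _ 1).
- move=> f g /asboolP sf /asboolP sg; apply/asboolP => i k.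
  exact: (CkD (@chart_im_open _ _ M i) (sf i k)
              (CkN (@chart_im_open _ _ M i) (sg i k))).
- move=> f g /asboolP sf /asboolP sg; apply/asboolP => i k.
  exact: (CkM (@chart_im_open _ _ M i) (sf i k) (sg i k)).
Qed.

HB.instance Definition _ :=
  GRing.isSubringClosed.Build (M -> R) smooth smooth_subring.

Record smoothFun := SmoothFun {
  smooth_fun :> M -> R;
  smooth_funP : smooth_fun \in smooth
}.

HB.instance Definition _ := [isSub for smooth_fun].
HB.instance Definition _ := [Choice of smoothFun by <:].
HB.instance Definition _ := 
  GRing.SubChoice_isSubComPzRing.Build _ _ smoothFun smooth_subring.

Lemma smooth_cst (c : R) : cst c \in smooth.
Proof. by apply/asboolP => i k; exact: (@Ck_cst _ _ _ _ c). Qed.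

Definition constf (c : R) : smoothFun := SmoothFun (smooth_cst c).

End SmoothFunctions.

Section Multilinear.
Variables (C : comPzRingType).

Definition upd (T : Type) k (v : 'I_k -> T) (i : 'I_k) (x : T) : 'I_k -> T :=
  fun j => if j == i then x else v j.

Lemma upd_same T k (v : 'I_k -> T) i x : upd v i x i = x.
Proof. by rewrite /upd eqxx. Qed.

Lemma upd_neq T k (v : 'I_k -> T) i x j : j != i -> upd v i x j = v j.
Proof. by rewrite /upd => /negbTE ->. Qed.

Lemma upd_id T k (v : 'I_k -> T) i : upd v i (v i) = v.
Proof. by apply/funext => j; rewrite /upd; case: eqP => // ->. Qed.

Lemma upd_upd T k (v : 'I_k -> T) i x y : upd (upd v i x) i y = upd v i y.
Proof. by apply/funext => j; rewrite /upd; case: eqP. Qed.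

Lemma updC T k (v : 'I_k -> T) i j x y : i != j ->
  upd (upd v i x) j y = upd (upd v j y) i x.
Proof.
move=> ij; apply/funext => l; rewrite /upd; case: eqP => // ->.
by rewrite eq_sym (negbTE ij).
Qed.

Lemma upd_lift T k (v : 'I_k.+1 -> T) i x : upd v i x \o lift i = v \o lift i.
Proof. by apply/funext => j /=; rewrite upd_neq// eq_sym neq_lift. Qed.

Lemma upd_lift_neq T k (v : 'I_k.+1 -> T) i j x :
  upd v (lift i j) x \o lift i = upd (v \o lift i) j x.
Proof.
by apply/funext => l; rewrite /upd /= (inj_eq (@lift_inj _ i)).
Qed.

Lemma lift_adj T k (v : 'I_k.+1 -> T) (p q : 'I_k.+1) :
  q = p.+1 :> nat -> v p = v q -> v \o lift p = v \o lift q.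
Proof.
move=> qp vpq.
  apply/funext => j /=; have [jp|jp] := eqVneq (j : nat) p.
  + have -> : lift p j = q by apply/val_inj; rewrite /= /bump jp qp leqnn.
    have -> : lift q j = p by apply/val_inj; rewrite /= /bump jp qp ltnn.
    by rewrite vpq.
  + congr v; apply/val_inj; rewrite /= /bump qp.
    by rewrite [in RHS]ltn_neqAle eq_sym jp.
Qed.

Section Alt.
Variables (V : lmodType C) (k : nat).

Definition alternating (w : ('I_k -> V) -> C) : Prop :=
  (forall v i a x y,
     w (upd v i (a *: x + y)) = a * w (upd v i x) + w (upd v i y)) /\
  (forall v i j, i != j -> v i = v j -> w v = 0).

Definition alternatingp : {pred ('I_k -> V) -> C^o} :=
  fun w => `[< alternating w >].

Lemma alternating_submod : submod_closed alternatingp.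
Proof.
split=> [|c w w' /asboolP[wl wa] /asboolP[w'l w'a]]; apply/asboolP; split.
- by move=> v i a x y; rewrite /= mulr0 addr0.
- by [].
- move=> v i a x y; rewrite !fctE wl w'l /= !scalerDr mulrDr addrACA.
  by rewrite /GRing.scale /= !mulrA (mulrC c).
- by move=> v i j ij vij; rewrite !fctE (wa v i j)// (w'a v i j)// scaler0 addr0.
Qed.

HB.instance Definition _ :=
  GRing.isSubmodClosed.Build C (('I_k -> V) -> C^o) alternatingp
    alternating_submod.

Record altForm := AltForm {
  alt_fun :> ('I_k -> V) -> C^o;
  alt_funP : alt_fun \in alternatingp
}.

HB.instance Definition _ := [isSub for alt_fun].
HB.instance Definition _ := [Choice of altForm by <:].
HB.instance Definition _ := [SubChoice_isSubLmodule of altForm by <:].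

Lemma altP (w : altForm) : alternating w.
Proof. exact/asboolP/alt_funP. Qed.

Lemma altDE (w w' : altForm) v : (w + w') v = w v + w' v.
Proof. by []. Qed.

Lemma altNE (w : altForm) v : (- w) v = - w v.
Proof. by []. Qed.

Lemma altZE c (w : altForm) v : (c *: w) v = c * w v.
Proof. by []. Qed.

Lemma alt_ext (w w' : altForm) : (forall v, w v = w' v) -> w = w'.
Proof. by move=> ww'; apply/val_inj/funext. Qed.

End Alt.

Section AltTheory.
Variables (V : lmodType C) (k : nat) (w : altForm V k).

Lemma altD v i x y : w (upd v i (x + y)) = w (upd v i x) + w (upd v i y).
Proof.
by have [wl _] := altP w; rewrite -[x in LHS]scale1r wl mul1r.
Qed.

Lemma alt0 v i : w (upd v i 0) = 0.
Proof.
by apply: (@addrI _ (w (upd v i 0))); rewrite addr0 -altD addr0.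
Qed.

Lemma altZ v i a x : w (upd v i (a *: x)) = a * w (upd v i x).
Proof.
by have [wl _] := altP w; rewrite -[_ *: x]addr0 wl alt0 addr0.
Qed.

Lemma alt_eq0 v i j : i != j -> v i = v j -> w v = 0.
Proof. by have [_ wa] := altP w; exact: wa. Qed.

Lemma alt_skew v i j x y : i != j ->
  w (upd (upd v i x) j y) + w (upd (upd v i y) j x) = 0.
Proof.
move=> ij; have h z : w (upd (upd v i z) j z) = 0.
  by apply: (alt_eq0 ij); rewrite upd_same upd_neq// upd_same.
have := h (x + y); rewrite altD !(updC v _ _ ij) !altD -!(updC v _ _ ij).
by rewrite !h add0r addr0 addrC.
Qed.

Lemma alt_upd2 v p q x : p != q -> v p = v q ->
  w (upd v p x) + w (upd v q x) = 0.
Proof.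
move=> pq vpq; have E : upd (upd v p x) q (v p) = upd v p x.
  apply/funext => l; rewrite {1}/upd; case: eqP => // ->.
  by rewrite upd_neq// eq_sym.
by have := alt_skew v x (v p) pq; rewrite E upd_id.
Qed.

End AltTheory.

Lemma swap_upd T k (v : 'I_k -> T) i j : 
  v \o tperm i j = upd (upd v i (v j)) j (v i).
Proof.
apply/funext => l /=; rewrite /upd; case: tpermP => [->|->|/eqP/negbTE-> /eqP/negbTE->//].
- by rewrite eqxx; case: eqP => // ->.
- by rewrite eqxx.
Qed.

(* It suffices to check alternation on neighbours and homogeneity in the last
   argument. *)
Lemma alternating_adj (V : lmodType C) k (w : ('I_k.+1 -> V) -> C) :
  (forall v i x y, w (upd v i (x + y)) = w (upd v i x) + w (upd v i y)) ->
  (forall v (i j : 'I_k.+1), j = i.+1 :> nat -> v i = v j -> w v = 0) ->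
  (forall v a x, w (upd v ord_max (a *: x)) = a * w (upd v ord_max x)) ->
  alternating w.
Proof.
move=> wD wadj wlast.
have skewP i j : i != j -> (forall v, v i = v j -> w v = 0) ->
    forall v, w (v \o tperm i j) = - w v.
  move=> ij h v; apply/eqP; rewrite -addr_eq0; apply/eqP.
  have h0 z : w (upd (upd v i z) j z) = 0.
    by apply: h; rewrite upd_same upd_neq// upd_same.
  have := h0 (v i + v j); rewrite wD !(updC v _ _ ij) !wD -!(updC v _ _ ij).
  by rewrite !h0 add0r addr0 !upd_id -swap_upd.
have walt_lt d : forall v (i j : 'I_k.+1), j = (i + d).+1 :> nat ->
    v i = v j -> w v = 0.
  elim: d => [|d IH] v i j; first by rewrite addn0; exact: wadj.
  move=> ji vij.
  have lt_l : ((i + d).+1 < k.+1)%N by apply: ltn_trans (ltn_ord j); rewrite ji addnS.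
  pose l := Ordinal lt_l.
  have jl : j = l.+1 :> nat by rewrite ji addnS.
  have lj : l != j by rewrite -val_eqE /= jl neq_ltn ltnSn.
  apply/eqP; rewrite -oppr_eq0 -(skewP l j lj); last first.
    by move=> u; exact: wadj.
  apply/eqP; apply: (IH _ i l) => //=.
  rewrite tpermL tpermD//; first by rewrite -val_eqE /= gtn_eqF// ltnS leq_addr.
  by rewrite -val_eqE /= ji gtn_eqF// ltnS leq_addr.
have walt v i j : i != j -> v i = v j -> w v = 0.
  rewrite -val_eqE /= neq_ltn => /orP[ij|ij] vij.
  - by apply: (walt_lt (j - i.+1)%N v i j) => //; rewrite -addSn subnKC.
  - by apply: (walt_lt (i - j.+1)%N v j i) => //; rewrite -addSn subnKC.
have wZ v i a x : w (upd v i (a *: x)) = a * w (upd v i x).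
  have [->//|iM] := eqVneq i ord_max.
  have sk u : w (u \o tperm i ord_max) = - w u.
    by apply: skewP => // u'; exact: walt.
  have E z : upd v i z \o tperm i ord_max =
             upd (v \o tperm i ord_max) ord_max z.
    apply/funext => l; rewrite /upd /=; congr (if _ then _ else _).
    by rewrite -(inj_eq (@perm_inj _ (tperm i ord_max))) tpermK tpermL.
  by apply: oppr_inj; rewrite -mulrN -!sk !E wlast.
by split=> // v i a x y; rewrite wD wZ.
Qed.

Section Lmap.
Variables (U V : lmodType C).

Definition linearp : {pred U -> V} := fun f => `[< linear f >].

Lemma linearp_submod : submod_closed linearp.
Proof.
split=> [|c f g /asboolP fl /asboolP gl]; apply/asboolP => a x y.
  by rewrite /= scaler0 addr0.
rewrite !fctE fl gl !scalerDr addrACA; congr (_ + _ + _).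
by rewrite !scalerA mulrC.
Qed.

HB.instance Definition _ :=
  GRing.isSubmodClosed.Build C (U -> V) linearp linearp_submod.

Record lmap := Lmap { lmap_fun :> U -> V; lmap_funP : lmap_fun \in linearp }.

HB.instance Definition _ := [isSub for lmap_fun].
HB.instance Definition _ := [Choice of lmap by <:].
HB.instance Definition _ := [SubChoice_isSubLmodule of lmap by <:].

Lemma lmapP (f : lmap) : linear f. Proof. exact/asboolP/lmap_funP. Qed.

Lemma lmapDE (f g : lmap) x : (f + g) x = f x + g x. Proof. by []. Qed.
Lemma lmapBE (f g : lmap) x : (f - g) x = f x - g x. Proof. by []. Qed.
Lemma lmapZE c (f : lmap) x : (c *: f) x = c *: f x. Proof. by []. Qed.

Lemma lmap_ext (f g : lmap) : (forall x, f x = g x) -> f = g.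
Proof. by move=> fg; apply/val_inj/funext. Qed.

HB.instance Definition _ (f : lmap) := GRing.isLinear.Build C U V *:%R f (lmapP f).

End Lmap.

End Multilinear.

Notation dual V := (@lmap _ V _^o).

Section Wedge.
Variables (C : comPzRingType) (V : lmodType C).

Definition wedge1_fun k (w : altForm V k) (b : dual V) (v : 'I_k.+1 -> V) : C^o :=
  \sum_(i < k.+1) (-1) ^+ (k - i) * (w (v \o lift i) * b (v i)).

Fact wedge1_subproof k (w : altForm V k) (b : dual V) :
  wedge1_fun w b \in @alternatingp C V k.+1.
Proof.
apply/asboolP/alternating_adj => [v p x y|v p q qp vpq|v c x].
- rewrite /wedge1_fun -big_split /=; apply: eq_bigr => i _.
  rewrite -mulrDr; congr (_ * _).
  case: (unliftP i p) => [p'|] ->.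
  + have e z : @upd V _ v (lift i p') z i = v i by apply: upd_neq; exact: neq_lift.
    rewrite !upd_lift_neq altD (e x) (e y) (e (x + y)).
    by rewrite mulrDl.
  + by rewrite !upd_same !upd_lift linearD mulrDr.
- have pq' : p != q by rewrite -val_eqE /= qp neq_ltn ltnSn.
  have qk : (q <= k)%N by rewrite -ltnS.
  rewrite /wedge1_fun (bigD1 p)//= (bigD1 q) 1?eq_sym//= (lift_adj qp vpq) -vpq.
  rewrite [X in _ + (_ + X)]big1 => [|i /andP[ip iq]].
    rewrite addr0 (_ : (k - p = (k - q).+1)%N); last by rewrite qp subnSK// -qp.
    by rewrite exprS mulN1r mulNr addNr.
  case: (unliftP i p) => [p'|] Ep; last by rewrite Ep eqxx in ip.
  case: (unliftP i q) => [q'|] Eq; last by rewrite Eq eqxx in iq.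
  have up : (v \o lift i) p' = (v \o lift i) q' by rewrite /= -Ep -Eq.
  have pq0 : p' != q' by apply: contraNneq pq' => e; rewrite Ep Eq e.
  by rewrite (alt_eq0 w pq0 up) mul0r mulr0.
- rewrite /wedge1_fun mulr_sumr; apply: eq_bigr => i _.
  rewrite [RHS]mulrCA; congr (_ * _).
  case: (unliftP i ord_max) => [p'|] E.
  + have e z : @upd V _ v (lift i p') z i = v i by apply: upd_neq; exact: neq_lift.
    rewrite E !upd_lift_neq altZ (e x) (e (c *: x)).
    by rewrite mulrA.
  + by rewrite -E !upd_same !upd_lift linearZ /= /GRing.scale /= mulrCA.
Qed.

(* w /\ b for a 1-form b, normalized by
   (a_1 /\ ... /\ a_k)(X_1, ..., X_k) = det (a_i X_j) *)
Definition wedge1 k (w : altForm V k) (b : dual V) : altForm V k.+1 :=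
  AltForm (wedge1_subproof w b).

Lemma wedge1_linear k (w : altForm V k) : linear (wedge1 w).
Proof.
move=> c b b'; apply: alt_ext => v; rewrite altDE altZE /= /wedge1_fun.
rewrite mulr_sumr -big_split /=; apply: eq_bigr => i _.
transitivity ((-1) ^+ (k - i) * (w (v \o lift i) * (c * b (v i) + b' (v i)))).
  by [].
by ring.
Qed.

HB.instance Definition _ k (w : altForm V k) :=
  GRing.isLinear.Build C (dual V) (altForm V k.+1) *:%R (wedge1 w)
    (wedge1_linear w).

End Wedge.

Section VectorFields.
Variables (R : realType) (m : nat) (M : smoothManifold R m).
Local Notation C := (smoothFun M).

Definition derivation : {pred C -> C^o} := fun X =>
  `[< (forall r f g, X (constf M r * f + g) = constf M r * X f + X g) /\
      (forall f g, X (f * g) = f * X g + g * X f) >].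

Lemma derivation_submod : submod_closed derivation.
Proof.
split=> [|c X Y /asboolP[Xl XM] /asboolP[Yl YM]]; apply/asboolP; split.
- by move=> r f g; rewrite /= mulr0 addr0.
- by move=> f g; rewrite /= !mulr0 addr0.
- move=> r f g; rewrite !fctE Xl Yl !scalerDr mulrDr addrACA.
  by rewrite /GRing.scale /= !mulrA (mulrC c).
- move=> f g; rewrite !fctE XM YM !scalerDr !mulrDr addrACA.
  by rewrite /GRing.scale /= !mulrA (mulrC c) (mulrC c g).
Qed.

HB.instance Definition _ :=
  GRing.isSubmodClosed.Build C (C -> C^o) derivation derivation_submod.

(* Vector fields on [M] as derivations of the [R]-algebra of smooth functions *)
Record vfield := VField { vf_fun :> C -> C^o; vf_funP : vf_fun \in derivation }.

HB.instance Definition _ := [isSub for vf_fun].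
HB.instance Definition _ := [Choice of vfield by <:].
HB.instance Definition _ := [SubChoice_isSubLmodule of vfield by <:].

Lemma vf_ext (X Y : vfield) : (forall f, X f = Y f) -> X = Y.
Proof. by move=> XY; apply/val_inj/funext. Qed.

Lemma constf1 : constf M 1 = 1. Proof. exact: val_inj. Qed.

Lemma vfM (X : vfield) f g : X (f * g) = f * X g + g * X f.
Proof. by have /asboolP[_] := vf_funP X. Qed.

Lemma vfL (X : vfield) r f g : X (constf M r * f + g) = constf M r * X f + X g.
Proof. by have /asboolP[] := vf_funP X. Qed.

Lemma vfD (X : vfield) f g : X (f + g) = X f + X g.
Proof. by have := vfL X 1 f g; rewrite constf1 !mul1r. Qed.

Lemma vf0 (X : vfield) : X 0 = 0.
Proof. by apply: (@addrI _ (X 0)); rewrite -vfD !addr0. Qed.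

Lemma vfN (X : vfield) f : X (- f) = - X f.
Proof. by apply: (@addrI _ (X f)); rewrite -vfD !subrr vf0. Qed.

Lemma vfB (X : vfield) f g : X (f - g) = X f - X g.
Proof. by rewrite vfD vfN. Qed.

Lemma vf_cst (X : vfield) r : X (constf M r) = 0.
Proof.
have X1 : X 1 = 0.
  have := vfM X 1 1; rewrite !mul1r => /(congr1 (+%R^~ (- X 1))).
  by rewrite subrr addrK.
by have := vfL X r 1 0; rewrite mulr1 addr0 X1 vf0 mulr0 addr0.
Qed.

Lemma vfDE (X Y : vfield) f : (X + Y) f = X f + Y f. Proof. by []. Qed.
Lemma vfNE (X : vfield) f : (- X) f = - X f. Proof. by []. Qed.
Lemma vfZE (X : vfield) c f : (c *: X) f = c * X f. Proof. by []. Qed.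
Lemma vf0E f : (0 : vfield) f = 0. Proof. by []. Qed.

Lemma lie_bracket_subproof (X Y : vfield) :
  (fun f => X (Y f) - Y (X f)) \in derivation.
Proof.
apply/asboolP; split.
- move=> r f g; rewrite (vfL Y) (vfL X) (vfL X r f) (vfL Y).
  by rewrite mulrBr opprD addrACA.
- move=> f g; rewrite !(vfM, vfD).
  move: (X (Y f)) (X (Y g)) (Y (X f)) (Y (X g)) (X f) (X g) (Y f) (Y g).
  by move=> a b c d e h p q; ring.
Qed.

Definition lie_bracket (X Y : vfield) : vfield :=
  VField (lie_bracket_subproof X Y).

Lemma lie_bracketE X Y f : lie_bracket X Y f = X (Y f) - Y (X f).
Proof. by []. Qed.

(* A Lie algebroid over [M], given by the [C]-module [V] of sections of the
   underlying vector bundle *)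
Record lieAlgebroid (V : lmodType C) := LieAlgebroid {
  anchor : {linear V -> vfield};
  la_br : V -> V -> V;
  la_brDl : forall a b c, la_br (a + b) c = la_br a c + la_br b c;
  la_brDr : forall a b c, la_br a (b + c) = la_br a b + la_br a c;
  la_brxx : forall a, la_br a a = 0;
  la_jacobi : forall a b c,
    la_br a (la_br b c) = la_br (la_br a b) c + la_br b (la_br a c);
  la_brZr : forall a f b, la_br a (f *: b) = f *: la_br a b + anchor a f *: b;
  la_anchor_br : forall a b,
    anchor (la_br a b) = lie_bracket (anchor a) (anchor b)
}.

Section TangentAlgebroid.

Fact tangent_brDl X Y Z :
  lie_bracket (X + Y) Z = lie_bracket X Z + lie_bracket Y Z.
Proof. by apply: vf_ext => f; rewrite !(vfDE, lie_bracketE) vfD; ring. Qed.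

Fact tangent_brDr X Y Z :
  lie_bracket X (Y + Z) = lie_bracket X Y + lie_bracket X Z.
Proof. by apply: vf_ext => f; rewrite !(vfDE, lie_bracketE) vfD; ring. Qed.

Fact tangent_brxx X : lie_bracket X X = 0.
Proof. by apply: vf_ext => f; rewrite lie_bracketE subrr. Qed.

Fact tangent_jacobi X Y Z :
  lie_bracket X (lie_bracket Y Z) =
  lie_bracket (lie_bracket X Y) Z + lie_bracket Y (lie_bracket X Z).
Proof. by apply: vf_ext => f; rewrite !(vfDE, lie_bracketE, vfB); ring. Qed.

Fact tangent_brZr X f Y : lie_bracket X (f *: Y) =
  f *: lie_bracket X Y + (idfun : {linear vfield -> vfield}) X f *: Y.
Proof.
by apply: vf_ext => g; rewrite !(vfDE, vfZE, lie_bracketE, vfM) /=; ring.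
Qed.

Definition tangentAlgebroid : lieAlgebroid vfield :=
  @LieAlgebroid vfield idfun lie_bracket tangent_brDl tangent_brDr tangent_brxx
    tangent_jacobi tangent_brZr (fun _ _ => erefl).

End TangentAlgebroid.

Section Calculus.
Variables (V : lmodType C) (A : lieAlgebroid V).
Local Notation rho := (anchor A).
Local Notation "[ a , b ]" := (la_br A a b).

Lemma la_brN a b : [a, b] = - [b, a].
Proof.
apply/eqP; rewrite -addr_eq0; apply/eqP; have := la_brxx A (a + b).
by rewrite la_brDl !la_brDr !la_brxx add0r addr0.
Qed.

Lemma la_brZl a f b : [f *: a, b] = f *: [a, b] - rho b f *: a.
Proof. by rewrite la_brN la_brZr opprD -scalerN -la_brN. Qed.

Lemma anchorD a b f : rho (a + b) f = rho a f + rho b f.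
Proof. by rewrite linearD. Qed.

Lemma anchorZ a c f : rho (c *: a) f = c * rho a f.
Proof. by rewrite linearZ. Qed.

Definition lieD_fun k (a : V) (w : altForm V k) (v : 'I_k -> V) : C^o :=
  rho a (w v) - \sum_i w (upd v i [a, v i]).

Fact lieD_subproof k a (w : altForm V k) :
  lieD_fun a w \in @alternatingp C V k.
Proof.
apply/asboolP; split=> [v p c x y|v p q pq vpq].
- have updE z i : i != p ->
      upd (upd v p z) i [a, upd v p z i] = upd (upd v i [a, v i]) p z.
    by move=> ip; rewrite upd_neq// updC// eq_sym.
  rewrite /lieD_fun altD altZ vfD vfM.
  rewrite (bigD1 p)//= [\sum_i w (upd (upd v p x) _ _)](bigD1 p)//=.
  rewrite [\sum_i w (upd (upd v p y) _ _)](bigD1 p)//= !upd_same !upd_upd.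
  rewrite la_brDr la_brZr !altD !altZ.
  under eq_bigr => i ip do rewrite updE// altD altZ.
  under [in RHS]eq_bigr => i ip do rewrite updE//.
  under [X in _ = _ + (_ - (_ + X))]eq_bigr => i ip do rewrite updE//.
  rewrite big_split /= -mulr_sumr; ring.
- rewrite /lieD_fun (alt_eq0 w pq vpq) vf0 (bigD1 p)//= (bigD1 q)//=; last first.
    by rewrite eq_sym.
  rewrite big1 => [|i /andP[ip iq]]; last first.
    by apply: (alt_eq0 w pq); rewrite !upd_neq// eq_sym.
  by rewrite addr0 -vpq (alt_upd2 w _ pq vpq) subr0.
Qed.

(* Lie derivative of the sections of the exterior powers of the dual of [A] *)
Definition lieD k a (w : altForm V k) : altForm V k := AltForm (lieD_subproof a w).

Lemma lieD_linear k a (w w' : altForm V k) f :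
  lieD a (f *: w + w') = f *: lieD a w + rho a f *: w + lieD a w'.
Proof.
apply: alt_ext => v; rewrite !(altDE, altZE) /= /lieD_fun.
rewrite !(altDE, altZE) vfD vfM.
under eq_bigr => i _ do rewrite altDE altZE.
by rewrite big_split /= -mulr_sumr; ring.
Qed.

Lemma lieD0 k a : lieD a (0 : altForm V k) = 0.
Proof. by apply: alt_ext => v /=; rewrite /lieD_fun vf0 big1// subr0. Qed.

(* In the usual formula for the differential,
   (-1)^(i+j) w([v_i, v_j], .., ^v_i, .., ^v_j, ..) with i < j is rewritten by moving
   [v_i, v_j] to the place of v_j, which gives the sign - (-1)^i. *)
Definition dext_fun k (w : altForm V k) (v : 'I_k.+1 -> V) : C^o :=
  \sum_(i < k.+1) (-1) ^+ i *
    (rho (v i) (w (v \o lift i)) -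
     \sum_(j < k | (i <= j)%N)
        w (upd (v \o lift i) j [v i, v (lift i j)])).

Fact dext_subproof k (w : altForm V k) :
  dext_fun w \in @alternatingp C V k.+1.
Proof.
apply/asboolP/alternating_adj => [v p x y|v p q qp vpq|v c x].
- rewrite /dext_fun -big_split /=; apply: eq_bigr => i _.
  rewrite -mulrDr; congr (_ * _); rewrite addrACA -opprD -big_split /=.
  case: (unliftP i p) => [p'|] ->.
  + rewrite !upd_lift_neq altD !(@upd_neq _ _ v (lift i p') _ i) ?neq_lift//.
    rewrite vfD; congr (_ - _); apply: eq_bigr => j _.
    have [->|jp] := eqVneq j p'; first by rewrite !upd_same !upd_upd la_brDr altD.
    rewrite !(@upd_neq _ _ v _ _ (lift i j)) ?(inj_eq (@lift_inj _ i))//.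
    by rewrite !(updC _ _ _ (_ : p' != j)) 1?eq_sym// altD.
  + rewrite !upd_same !upd_lift anchorD; congr (_ - _).
    apply: eq_bigr => j _; rewrite !(@upd_neq _ _ v i _ (lift i j)); last first.
      1,2,3: by rewrite eq_sym neq_lift.
    by rewrite la_brDl altD.
- have pq' : p != q by rewrite -val_eqE /= qp neq_ltn ltnSn.
  have E := lift_adj qp vpq.
  have pk : (p < k)%N by have := ltn_ord q; rewrite qp ltnS.
  rewrite /dext_fun (bigD1 p)//= (bigD1 q) 1?eq_sym//= E -vpq.
  rewrite [X in _ + (_ + X)]big1 => [|i /andP[ip iq]].
    have Eq j : v (lift q j) = v (lift p j) := esym (congr1 (@^~ j) E).
    rewrite (bigD1 (Ordinal pk))//= (_ : v (lift p _) = v p); last first.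
      rewrite vpq; congr v; apply/val_inj.
      by rewrite /= /bump leqnn qp.
    rewrite la_brxx alt0 add0r addr0 qp exprS mulN1r mulNr.
    apply/eqP; rewrite subr_eq0; apply/eqP; congr (_ * (_ - _)).
    apply: eq_big => [j|j _]; last by rewrite Eq.
    by rewrite -val_eqE /= [RHS]ltn_neqAle eq_sym andbC.
  case: (unliftP i p) => [p'|] Ep; last by rewrite Ep eqxx in ip.
  case: (unliftP i q) => [q'|] Eq; last by rewrite Eq eqxx in iq.
  have up : (v \o lift i) p' = (v \o lift i) q' by rewrite /= -Ep -Eq.
  have pq0 : p' != q' by apply: contraNneq pq' => e; rewrite Ep Eq e.
  rewrite (alt_eq0 w pq0 up) vf0 sub0r.
  have ipq : (i <= p')%N = (i <= q')%N.
    move: ip iq qp; rewrite -!val_eqE /= Ep Eq /= /bump.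
    by case: leqP => ?; case: leqP => ? //= _ _; lia.
  have [ip'|ip'] := boolP (i <= p')%N; last first.
    rewrite big1 ?oppr0 ?mulr0// => j ij; apply: (alt_eq0 w pq0).
    have jp : p' != j by apply: contraNneq ip' => ->.
    have jq : q' != j by apply: contraNneq ip' => e; rewrite ipq e.
    by rewrite !upd_neq.
  rewrite (bigD1 p')//= (bigD1 q')/=; last by rewrite -ipq ip' eq_sym.
  rewrite big1 => [|j /andP[/andP[_ jp] jq]]; last first.
    by apply: (alt_eq0 w pq0); rewrite !upd_neq// eq_sym.
  by rewrite -Ep -Eq -vpq addr0 (alt_upd2 w _ pq0 up) oppr0 mulr0.
- rewrite /dext_fun mulr_sumr; apply: eq_bigr => i _.
  rewrite mulrCA; congr (_ * _).
  case: (unliftP i ord_max) => [p'|] E.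
  + have ip' : (i <= p')%N.
      have := congr1 val E; rewrite /= /bump; case: leqP => // _ kp'.
      by have := ltn_ord p'; rewrite [X in (_ < X)%N]kp' ltnn.
    rewrite E !upd_lift_neq altZ !(@upd_neq _ _ v (lift i p') _ i) ?neq_lift//.
    rewrite vfM (bigD1 p')//= [in RHS](bigD1 p')//= !upd_same !upd_upd.
    rewrite la_brZr altD !altZ.
    under eq_bigr => j /andP[_ jp].
      rewrite (@upd_neq _ _ v _ _ (lift i j)) ?(inj_eq (@lift_inj _ i))//.
      rewrite (updC _ _ _ (_ : p' != j)) 1?eq_sym// altZ.
      over.
    under [in RHS]eq_bigr => j /andP[_ jp].
      rewrite (@upd_neq _ _ v _ _ (lift i j)) ?(inj_eq (@lift_inj _ i))//.
      rewrite (updC _ _ _ (_ : p' != j)) 1?eq_sym//.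
      over.
    by rewrite -mulr_sumr /=; ring.
  + rewrite -E !upd_same !upd_lift anchorZ.
    rewrite !big_pred0 ?subr0// => j; apply/negbTE; rewrite -ltnNge; exact: ltn_ord.
Qed.

Definition dext k (w : altForm V k) : altForm V k.+1 := AltForm (dext_subproof w).

End Calculus.
End VectorFields.

Section ModularClass.
Variables (R : realType) (m : nat) (M : smoothManifold R m).
Local Notation C := (smoothFun M).
Section Cohomology.
Variables (V : lmodType C) (A : lieAlgebroid V).
Local Notation rho := (anchor A).

Definition cocycle : {pred dual V} := fun th =>
  `[< forall a b, rho a (th b) - rho b (th a) - th (la_br A a b) = 0 >].

Lemma cocycle_zmod : zmod_closed cocycle.
Proof.
split=> [|th th' /asboolP h /asboolP h']; apply/asboolP => a b.
  by rewrite !vf0 !subr0.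
rewrite !lmapBE !vfB -[RHS](subrr (0 : C)) -{1}(h a b) -(h' a b); ring.
Qed.

HB.instance Definition _ :=
  GRing.isZmodClosed.Build (dual V) cocycle cocycle_zmod.

Record cocycle1 := Cocycle1 {
  cocycle1_val :> lmap V C^o;
  cocycle1P : cocycle1_val \in cocycle
}.

HB.instance Definition _ := [isSub for cocycle1_val].
HB.instance Definition _ := [Choice of cocycle1 by <:].
HB.instance Definition _ := [SubChoice_isSubZmodule of cocycle1 by <:].

Definition coboundary : {pred cocycle1} := fun th =>
  `[< exists f, forall a, th a = rho a f >].

Lemma coboundary_zmod : zmod_closed coboundary.
Proof.
split=> [|th th' /asboolP[f h] /asboolP[f' h']]; apply/asboolP.
  by exists 0 => a; rewrite vf0.
by exists (f - f') => a; rewrite vfB -h -h'.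
Qed.

HB.instance Definition _ :=
  GRing.isZmodClosed.Build cocycle1 coboundary coboundary_zmod.

(* First Lie algebroid cohomology with trivial coefficients *)
Definition H1 := Quotient.quot coboundary.

HB.instance Definition _ :=
  GRing.Zmodule.copy H1 (Quotient.quot coboundary).

Definition cohomology_class (th : cocycle1) : H1 := (\pi_H1 th)%qT.

Lemma cohomology_classD (th th' : cocycle1) :
  cohomology_class (th + th') = cohomology_class th + cohomology_class th'.
Proof. exact: Quotient.pi_add. Qed.

Lemma cohomology_class_eq (th th' : cocycle1) :
  cohomology_class th = cohomology_class th' <->
  exists f, forall a, th a - th' a = rho a f.
Proof.
split=> [/eqP|h]; last apply/eqP.
  by rewrite -Quotient.idealrBE => /asboolP.
by rewrite -Quotient.idealrBE; apply/asboolP.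
Qed.

End Cohomology.

Section ModularAlgebroid.
Variables (V : lmodType C) (A : lieAlgebroid V).
Local Notation rho := (anchor A).
Local Notation T := (tangentAlgebroid M).

(* Sections of the k-th exterior power of [A], as the C-dual of the sections of
   the k-th exterior power of its dual bundle *)
Definition multisection k := dual (altForm V k).

Definition decomposable k (v : 'I_k -> V) (w : altForm V k) : C^o := w v.

Fact decomposable_subproof k (v : 'I_k -> V) :
  decomposable v \in @linearp C (altForm V k) C^o.
Proof. exact/asboolP. Qed.

Definition wedge_sec k (v : 'I_k -> V) : multisection k :=
  Lmap (decomposable_subproof v).

Definition gerst_fun k (a : V) (X : multisection k) (w : altForm V k) : C^o :=
  rho a (X w) - X (lieD A a w).

Fact gerst_subproof k a (X : multisection k) :
  gerst_fun a X \in @linearp C (altForm V k) C^o.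
Proof.
apply/asboolP => c w w'; rewrite /gerst_fun lieD_linear !linearD !linearZ /=.
by rewrite vfD vfM /GRing.scale /=; ring.
Qed.

(* Gerstenhaber bracket of a section with a multisection, determined by the two
   properties proved below *)
Definition gerst k a (X : multisection k) : multisection k :=
  Lmap (gerst_subproof a X).

Lemma gerst_wedge k a (v : 'I_k -> V) :
  gerst a (wedge_sec v) = \sum_i wedge_sec (upd v i (la_br A a (v i))).
Proof.
apply/val_inj/funext => w; rewrite /= /gerst_fun /= /decomposable /lieD_fun.
rewrite opprB addrCA subrr addr0.
pose ev (X : multisection k) : C := X w.
have evD : {morph ev : X Y / X + Y >-> X + Y} by [].
by rewrite -/(ev _) (big_morph ev evD (erefl : ev 0 = 0)).
Qed.

Lemma gerst_scale k a (f : C) (X : multisection k) :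
  gerst a (f *: X) = f *: gerst a X + rho a f *: X.
Proof.
apply: lmap_ext => w; rewrite !(lmapDE, lmapZE) /= /gerst_fun !lmapZE.
by rewrite /GRing.scale /= vfM; ring.
Qed.

Definition diffForm k := altForm (vfield M) k.

(* Sections of Hom(/\^r A^*, /\^m T^*M) = /\^r A (x) /\^m T^*M, where r stands
   for the rank of [A] *)
Definition Qsection r := lmap (altForm V r) (diffForm m).

Definition Qtensor_fun r (X : multisection r) (nu : diffForm m) (w : altForm V r) :=
  X w *: nu.

Fact Qtensor_subproof r (X : multisection r) (nu : diffForm m) :
  Qtensor_fun X nu \in @linearp C (altForm V r) (diffForm m).
Proof.
by apply/asboolP => c w w'; rewrite /Qtensor_fun linearP scalerDl scalerA.
Qed.

Definition Qtensor r (X : multisection r) nu : Qsection r :=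
  Lmap (Qtensor_subproof X nu).

Definition Qnabla_fun r (a : V) (S : Qsection r) (w : altForm V r) : diffForm m :=
  lieD T (rho a) (S w) - S (lieD A a w).

Fact Qnabla_subproof r a (S : Qsection r) :
  Qnabla_fun a S \in @linearp C (altForm V r) (diffForm m).
Proof.
apply/asboolP => c w w'; rewrite /Qnabla_fun lieD_linear !linearD !linearZ /=.
rewrite lieD_linear; apply: alt_ext => v; rewrite !(altDE, altZE, altNE) /=.
by ring.
Qed.

(* The representation of [A] on Q_A; see [Qnabla_tensor] *)
Definition Qnabla r a (S : Qsection r) : Qsection r := Lmap (Qnabla_subproof a S).

Lemma Qnabla_tensor r a (X : multisection r) (nu : diffForm m) :
  Qnabla a (Qtensor X nu) =
  Qtensor (gerst a X) nu + Qtensor X (lieD T (rho a) nu).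
Proof.
apply: lmap_ext => w.
change (lieD T (rho a) (X w *: nu) - X (lieD A a w) *: nu =
  (rho a (X w) - X (lieD A a w)) *: nu + X w *: lieD T (rho a) nu).
have := lieD_linear T (rho a) nu 0 (X w); rewrite addr0 lieD0 addr0 => ->.
by rewrite scalerBl -addrA addrC.
Qed.

(* The cochain theta_s of a nowhere vanishing section s *)
Definition is_char_cochain (L : lmodType C) (nabla : V -> L -> L) (s : L)
    (th : V -> C) : Prop :=
  forall a, nabla a s = th a *: s.

Definition Qnowhere_zero r (s : Qsection r) : Prop :=
  forall p, exists w, exists X, s w X p != 0.

(* [c] is the Evens-Lu-Weinstein modular class of [A], [r] being the rank of [A]
   and the line bundle Q_A being trivial *)
Definition is_ELW_modular_class r (c : H1 A) : Prop :=
  exists s : Qsection r, exists th : cocycle1 A,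
    [/\ Qnowhere_zero s, is_char_cochain (@Qnabla r) s th
      & c = cohomology_class th].

End ModularAlgebroid.

Definition tangent_vector (p : M) (v : C -> R) : Prop :=
  (forall r f g, v (constf M r * f + g) = r * v f + v g) /\
  (forall f g, v (f * g) = f p * v g + g p * v f).

Definition parallelizable : Prop :=
  exists E : 'I_m -> vfield M, forall p v, tangent_vector p v ->
    exists! c : 'I_m -> R, forall f, v f = \sum_i c i * E i f p.

(* k-vector fields, as functionals on k-forms, the value P(a_1 /\ ... /\ a_k) being
   P(a_1, ..., a_k) *)
Definition multivector k := dual (diffForm k).

Definition volume_form (eta : diffForm m) : Prop :=
  forall p, exists X, eta X p != 0.

Fact dfun_subproof f : (fun X : vfield M => X f) \in @linearp C (vfield M) C^o.
Proof. exact/asboolP. Qed.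

Definition dfun f : dual (vfield M) := Lmap (dfun_subproof f).

End ModularClass.

Section Sharp.
Variables (R : realType) (m : nat) (M : smoothManifold R m).
Local Notation C := (smoothFun M).

Lemma dfunL r f g : dfun (constf M r * f + g) = constf M r *: dfun f + dfun g.
Proof. by apply: lmap_ext => X; rewrite lmapDE lmapZE /= vfL. Qed.

Lemma dfunM (f g : C) : dfun (f * g) = f *: dfun g + g *: dfun f.
Proof. by apply: lmap_ext => X; rewrite lmapDE !lmapZE /= vfM. Qed.

Fact sharp_subproof k (P : multivector M k.+1) (al : diffForm M k) :
  (fun f => P (wedge1 al (dfun f))) \in @derivation R m M.
Proof.
apply/asboolP; split=> [r f g|f g]; rewrite ?dfunL ?dfunM linearD !linearZ /=.
- by rewrite linearD linearZ.
- by rewrite linearD !linearZ.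
Qed.

(* The contraction of P with [al], as a vector field: its value on df is
   P(al /\ df) *)
Definition sharp k (P : multivector M k.+1) (al : diffForm M k) : vfield M :=
  VField (sharp_subproof P al).

End Sharp.

Section Nambu.
Variables (R : realType) (n : nat) (M : smoothManifold R n.+1).
Variable (P : multivector M n.+1).
Local Notation C := (smoothFun M).
Local Notation T := (tangentAlgebroid M).
Implicit Types (al be : diffForm M n).

Definition is_nambu_algebroid (A : lieAlgebroid (diffForm M n)) : Prop :=
  (forall al, anchor A al = sharp P al) /\
  (forall al be, la_br A al be =
     lieD T (sharp P al) be + ((-1) ^+ n.+1 * P (dext T al)) *: be).

Definition is_modular_tensor (eta : diffForm M n.+1) (N : multivector M n) : Prop :=
  forall al, N al *: eta =
    lieD T (sharp P al) eta + ((-1) ^+ n.+1 * P (dext T al)) *: eta.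

(* As the sections of the algebroid are the n-forms, an n-vector field is a
   1-cochain, whose value on [al] is the contraction of [al] with it. *)
Definition is_nambu_modular_class (A : lieAlgebroid (diffForm M n)) (c : H1 A) : Prop :=
  exists eta : diffForm M n.+1, exists N : cocycle1 A,
    [/\ volume_form eta, is_modular_tensor eta N & c = cohomology_class N].

End Nambu.

(* Main.v *)
(* Fix a frame E of TM with dual coframe e and the volume form omega = e_0 /\ .. /\ e_n,
   and write P(omega) = pi.  An n-form al corresponds to a vector field k(al) by
   al /\ df = k(al)(f) omega.  Then the anchor is al |-> pi k(al),
   P(d al) = (-1)^n pi div(k(al)), and the bracket becomes
   [X, Y] |-> [pi X, Y] + X(pi) Y on vector fields.  The modular tensor of omega is
   therefore al |-> div(pi X) - pi div(X) = X(pi) with X = k(al), while the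
   Evens-Lu-Weinstein cochain of the frame of Q_A is
   tr(Y |-> [pi X, Y] + X(pi) Y) + div(pi X) = (n + 1) X(pi), because
   div(Z) = - tr([Z, -]) in the frame.  Two sections of a trivial line bundle differ by
   a nowhere vanishing function g, and the cochains by rho(-)(ln|g|).  As vector fields
   are derivations of the ring of smooth functions, this needs X(ln|g|) = X(g) / g for
   an arbitrary derivation X. *)
From HB Require Import structures.
Require Import Defs.
From mathcomp Require Import all_boot all_order all_algebra perm.
From mathcomp Require Import boolp classical_sets functions reals topology.
From mathcomp Require Import normedtype sequences derive realfun exp.
From mathcomp Require Import ring lra zify.

Set Implicit Arguments.
Unset Strict Implicit.
Unset Printing Implicit Defensive.

Import Order.TTheory GRing.Theory Num.Theory numFieldNormedType.Exports.
Local Open Scope classical_set_scope.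
Local Open Scope ring_scope.

(** * Smooth functions of one variable and composition *)

Section OneVariable.
Variable R : realType.
Implicit Types (F : set (R -> R)) (O : set R).

(** Smoothness of the members of [F] on [O], in a form suited to induction on the order of
    derivation: derivatives are taken at points of [O] only and stay in the family. *)
Definition closed_under_derivative O F : Prop :=
  forall phi, F phi -> exists2 phi', F phi' &
    forall t, O t -> is_derive t (1 : R) phi (phi' t).

(** Restriction to a line reduces directional derivatives to one variable, where the chain rule
    [is_derive1_comp] applies. *)
Lemma is_derive_line (V : normedModType R) (f : V -> R) (x v : V) l :
  is_derive x v f l <-> is_derive (0 : R) (1 : R) (fun h : R => f (h *: v + x)) l.
Proof.
have E : 'D_v f x = 'D_1 (fun h : R => f (h *: v + x)) 0.
  rewrite /derive; set g1 := (X in X @ _); set g2 := (X in _ = lim (X @ _)).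
  suff -> : g1 = g2 by [].
  apply/funext => h; rewrite /g1 /g2 /=.
  by rewrite addr0 scale0r add0r [h%:A]mulr1.
by split=> -[dx <-]; split; rewrite ?E//; apply/(derivable1P f x v).
Qed.

Lemma is_derive_comp1 (V : normedModType R) (phi : R -> R) (g : V -> R) x v a b :
  is_derive (g x) (1 : R) phi a -> is_derive x v g b ->
  is_derive x v (phi \o g) (a * b).
Proof.
move=> dphi /is_derive_line dg; apply/is_derive_line.
apply: (@is_derive1_comp _ phi (fun h => g (h *: v + x))) => //.
by rewrite scale0r add0r.
Qed.

(** The partial derivatives of [phi \o g] are those of [g] times [phi' \o g], and [phi'] is again in
    [F]; so the induction on [k] treats all members of [F] at once. *)
Lemma Ck_comp m O F k (U : set 'rV[R]_m) (phi : R -> R) g :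
  closed_under_derivative O F -> F phi -> open U ->
  (forall x, U x -> O (g x)) -> Ck k U g -> Ck k U (phi \o g).
Proof.
move=> dF Fphi oU gO; elim: k phi Fphi => [|k IH] phi Fphi Cg; last first.
  have [phi' Fphi' dphi] := dF _ Fphi; have [cg dg Dg] := Cg.
  have D i x : U x -> is_derive x (delta_mx 0 i) (phi \o g)
      (phi' (g x) * 'D_(delta_mx 0 i) g x).
    move=> Ux; apply: is_derive_comp1; first exact/dphi/gO.
    exact: derivableP (dg x i Ux).
  split.
  - move=> x Ux; apply: continuous_comp; first exact: cg.
    by apply/differentiable_continuous/derivable1_diffP; case: (dphi _ (gO _ Ux)).
  - by move=> x i Ux; case: (D i x Ux).
  - move=> i; apply: (eq_Ck oU) (CkM oU (IH _ Fphi' (CkW Cg)) (Dg i)) => x Ux.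
    by case: (D i x Ux) => _ ->.
have [phi' Fphi' dphi] := dF _ Fphi.
move=> x Ux; apply: continuous_comp; first exact: Cg.
by apply/differentiable_continuous/derivable1_diffP; case: (dphi _ (gO _ Ux)).
Qed.

Definition inverse_powers : set (R -> R) :=
  [set phi | exists c k, phi = fun t => c * t^-1 ^+ k].

Lemma inverse_powers_derivative :
  closed_under_derivative [set t | t != 0] inverse_powers.
Proof.
move=> _ [c [k ->]]; exists (fun t => - (c * k%:R) * t^-1 ^+ k.+1).
  by exists (- (c * k%:R)), k.+1.
move=> t /= t0.
(* The right side is what the chain rule gives for [t^-1] followed by [c * u ^+ k]; the case [k = 0]
   is apart because of [k.-1]. *)
have -> : - (c * k%:R) * t^-1 ^+ k.+1 = (c * (k%:R * t^-1 ^+ k.-1)) * (- t ^- 2).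
  case: k => [|k]; first by rewrite !mulr0n !(mul0r, mulr0, oppr0).
  by rewrite /= -exprVn -[k.+2]/(2 + k)%N exprD; ring.
have dX : is_derive t^-1 (1 : R) (fun u : R => c * u ^+ k)
    (c * (k%:R * t^-1 ^+ k.-1)).
  have := is_deriveZ c (is_deriveX k (is_derive_id t^-1 (1 : R))).
  by rewrite fctE /GRing.scale /= mulr1.
have dV : is_derive t (1 : R) (@GRing.inv R) (- t ^- 2).
  have := is_deriveV t0 (is_derive_id t (1 : R)).
  by rewrite /GRing.scale /= mulr1.
exact: is_derive_comp1 dX dV.
Qed.

Definition ln_inverse_powers : set (R -> R) :=
  [set phi | phi = @ln R \/ inverse_powers phi].

Lemma ln_inverse_powers_derivative :
  closed_under_derivative [set t | 0 < t] ln_inverse_powers.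
Proof.
move=> phi [->|Fphi].
  exists (fun t => 1 * t^-1 ^+ 1); first by right; exists 1, 1%N.
  by move=> t t0; rewrite mul1r expr1; exact: is_derive1_ln.
have [phi' Fphi' dphi] := inverse_powers_derivative Fphi.
by exists phi' => [|t t0]; [right|apply: dphi; rewrite /= gt_eqF].
Qed.

(** This bound makes the power series converge everywhere and survives termwise differentiation,
    since (k + 1) / (k + 1)! = 1 / k!. The sums thus form a family closed under derivation. *)
Definition dominated_by_exp (c : nat -> R) : Prop :=
  exists B, forall k, `|c k| <= B / k`!%:R.

Lemma dominated_by_exp_cvg c x : dominated_by_exp c -> cvgn (pseries c x).
Proof.
move=> [B cB]; apply: normed_cvg.
apply: (@series_le_cvg _ _ (B *: exp_coeff `|x|)) => [k|k|k|].
- exact: normr_ge0.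
- have := cB 0%N; rewrite divr1 => /(le_trans (normr_ge0 _)) B0.
  by rewrite mulr_ge0// exp_coeff_ge0.
- rewrite /= normrM normrX; apply: le_trans (ler_wpM2r _ (cB k)) _.
    exact: exprn_ge0.
  by rewrite -mulrA [X in B * X]mulrC.
- by apply: is_cvg_seriesZ; exact: is_cvg_series_exp_coeff.
Qed.

Lemma dominated_by_exp_diffs c :
  dominated_by_exp c -> dominated_by_exp (pseries_diffs c).
Proof.
move=> [B cB]; exists B => k; rewrite /pseries_diffs normrM normr_nat.
apply: le_trans (ler_wpM2l _ (cB k.+1)) _ => //.
by rewrite factS natrM invfM mulrCA mulVKf// pnatr_eq0.
Qed.

Definition exp_dominated_series : set (R -> R) :=
  [set phi | exists2 c, dominated_by_exp c & phi = fun x => limn (pseries c x)].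

Lemma exp_dominated_series_derivative :
  closed_under_derivative setT exp_dominated_series.
Proof.
move=> _ [c cB ->]; have c'B := dominated_by_exp_diffs cB.
exists (fun x => limn (pseries (pseries_diffs c) x)).
  by exists (pseries_diffs c).
(* Convergence is required at some point of modulus larger than |t|; |t| + 1 serves. *)
move=> t _; apply: (@pseries_snd_diffs _ _ (`|t| + 1)).
- exact: dominated_by_exp_cvg.
- exact: dominated_by_exp_cvg.
- exact/dominated_by_exp_cvg/dominated_by_exp_diffs.
- by rewrite [ltRHS]ger0_norm ?ltrDl// addr_ge0.
Qed.

(* The quotient (e^x - 1) / x, extended by 1 at 0. *)
Definition expR_quot (x : R) : R := limn (pseries (fun k => (k.+1)`!%:R^-1) x).

Fact expR_quot_dominated : dominated_by_exp (fun k => (k.+1)`!%:R^-1).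
Proof.
exists 1 => k; rewrite mul1r ger0_norm ?invr_ge0// lef_pV2 ?posrE ?ltr0n ?fact_gt0//.
by rewrite ler_nat factS leq_pmull.
Qed.

Lemma expR_quot_exp_dominated : exp_dominated_series expR_quot.
Proof. by exists (fun k => (k.+1)`!%:R^-1); first exact: expR_quot_dominated. Qed.

Lemma expR_quotE x : expR x = 1 + x * expR_quot x.
Proof.
have cv := dominated_by_exp_cvg (x := x) expR_quot_dominated.
apply: cvg_lim => //; rewrite -cvg_shiftS /=.
(* After the shift, the first term 1 of the exponential series splits off and the others share a
   factor [x]. *)
rewrite [X in X @ _](_ : _ =
    (fun n => 1 + x * pseries (fun k => (k.+1)`!%:R^-1) x n)).
  by apply: cvgD; [exact: cvg_cst|apply: cvgMr].
apply/funext => n; rewrite /pseries /series /= big_nat_recl//.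
rewrite /exp_coeff /= expr0 divr1 mulr_sumr; congr (_ + _).
by apply: eq_bigr => i _; rewrite exprS -mulrA; congr (_ * _); rewrite mulrC.
Qed.

Lemma expR_quot0 : expR_quot 0 = 1.
Proof.
apply: cvg_lim => //; rewrite -cvg_shiftS /=.
rewrite [X in X @ _](_ : _ = fun=> 1); first exact: cvg_cst.
apply/funext => n; rewrite /pseries /series /= big_nat_recl// big1 ?addr0.
  by rewrite expr0 mulr1 invr1.
by move=> i _; rewrite expr0n mulr0.
Qed.

End OneVariable.

(** * Logarithms of smooth functions on a manifold *)

Section LocalSmoothness.
Variables (R : realType) (m : nat).
Implicit Types (U W : set 'rV[R]_m) (f : 'rV[R]_m -> R).

(** Every clause of [Ck] is a condition at single points, phrased with neighbourhoods in the whole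
    space; so the sets [W] may be arbitrary. *)
Lemma Ck_local k U f :
  (forall x, U x -> exists2 W, W x & Ck k W f) -> Ck k U f.
Proof.
elim: k f => [|k IH] f h /=; first by move=> x /h[W Wx cf]; exact: cf.
split=> [x /h[W Wx [cf _ _]]|x i /h[W Wx [_ df _]]|i]; [exact: cf|exact: df|].
by apply: IH => x Ux; have [W Wx [_ _ Df]] := h x Ux; exists W => //; exact: Df.
Qed.

Lemma Ck_subset k U W f : W `<=` U -> Ck k U f -> Ck k W f.
Proof. by move=> WU CU; apply: Ck_local => x /WU Ux; exists U. Qed.

End LocalSmoothness.

Section SmoothOnManifold.
Variables (R : realType) (m : nat) (M : smoothManifold R m).
Local Notation C := (smoothFun M).

Lemma smooth_funE (f : C) i :
  smooth_on (chart i @` chart_dom i) (f \o @chart_inv _ _ M i).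
Proof. by have /asboolP := smooth_funP f; apply. Qed.

Lemma smooth_comp (O : set R) F phi (f : C) :
  closed_under_derivative O F -> F phi -> (forall p, O (f p)) ->
  phi \o f \in @smooth R m M.
Proof.
move=> dF Fphi fO; apply/asboolP => i k.
apply: (Ck_comp dF Fphi (@chart_im_open _ _ M i) _ (smooth_funE f i k)) => x _.
exact: fO.
Qed.

(** Near a point where [d] does not vanish, [c] is g / d, and the pair may change with the point.
    This is the shape in which Cramer's rule yields coefficients in [parallelizable_frame]. *)
Lemma smooth_quotient (c : M -> R) :
  (forall p, exists d g : C, d p != 0 /\ forall q, c q * d q = g q) ->
  c \in @smooth R m M.
Proof.
move=> cP; apply/asboolP => i k; apply: Ck_local => x Ux.
have [d [g [dp cd]]] := cP (@chart_inv _ _ M i x).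
set U := chart i @` _ in Ux; pose d' := d \o @chart_inv _ _ M i.
exists (U `&` [set y | d' y != 0]) => //.
have oU : open U by exact: chart_im_open.
have oW : open (U `&` [set y | d' y != 0]).
  rewrite openE => y [Uy dy]; apply: filterI; first exact: open_nbhs_nbhs.
  have cd' : d' @ y --> d' y := Ck_cont (smooth_funE d i 0) Uy.
  exact: cvgr_neq0 cd' dy.
have CV : Ck k (U `&` [set y | d' y != 0]) ((fun t => 1 * t^-1 ^+ 1) \o d').
  apply: Ck_comp (@inverse_powers_derivative R) _ oW _ _.
  - by exists 1, 1%N.
  - by move=> y [].
  - exact: Ck_subset (@subIsetl _ _ _) (smooth_funE d i k).
apply: (eq_Ck oW) (CkM oW (Ck_subset (@subIsetl _ _ _) (smooth_funE g i k)) CV).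
by move=> y [Uy dy]; rewrite fctE /= -cd expr1 mul1r mulfK.
Qed.

(* Writing f = e^c (1 + h q) with h = ln f - c, c = ln f(p) and q = (e^h - 1) / h,
   the Leibniz rule alone computes X f at p, since h(p) = 0. *)
Lemma exists_ln (f : C) : (forall p, 0 < f p) ->
  exists l : C, forall X : vfield M, X f = f * X l.
Proof.
move=> f0.
have ls : @ln R \o f \in @smooth R m M.
  by apply: smooth_comp (@ln_inverse_powers_derivative R) _ f0; left.
exists (SmoothFun ls) => X; apply/val_inj/funext => p.
set l : C := SmoothFun ls.
pose h : C := l - constf M (l p).
have qs : @expR_quot R \o h \in @smooth R m M.
  apply: smooth_comp (@exp_dominated_series_derivative R) _ _; last by [].
  exact: expR_quot_exp_dominated.
pose q : C := SmoothFun qs.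
have hp : h p = 0 by exact: subrr.
have fE : f = constf M (f p) * (1 + h * q) + 0.
  rewrite addr0; apply/val_inj/funext => r.
  change (f r = f p * (1 + h r * expR_quot (h r))).
  rewrite -expR_quotE -[f p]lnK ?posrE ?f0// -expRD.
  by rewrite (_ : ln (f p) + h r = ln (f r)) ?lnK ?posrE ?f0// addrC subrK.
have X1 : X 1 = 0 by rewrite -constf1 vf_cst.
have Xh : X h = X l by rewrite vfB vf_cst subr0.
rewrite {1}fE vfL vf0 addr0 vfD X1 add0r vfM Xh.
change (f p * (h p * X q p + expR_quot (h p) * X l p) = f p * X l p).
by rewrite hp mul0r add0r expR_quot0 mul1r.
Qed.

(** The ring of smooth functions may have zero divisors, so cancellation goes point by point. *)
Lemma smoothFun_mulI (g a b : C) :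
  (forall p, g p != 0) -> g * a = g * b -> a = b.
Proof.
move=> g0 gab; apply/val_inj/funext => p; apply: (mulfI (g0 p)).
exact: (congr1 (fun u => smooth_fun u p) gab).
Qed.

(** [l] is half the logarithm of g^2, that is ln|g|, because X(g^2) = 2 g X(g). *)
Lemma exists_ln_abs (g : C) : (forall p, g p != 0) ->
  exists l : C, forall X : vfield M, X g = g * X l.
Proof.
move=> g0; have gg0 p : 0 < (g * g) p.
  by change (0 < g p * g p); rewrite -expr2 exprn_even_gt0//= g0.
have [l Xl] := exists_ln gg0; exists (constf M 2^-1 * l) => X.
apply: (smoothFun_mulI g0); have := Xl X; rewrite vfM.
move=> /(congr1 (GRing.mul (constf M 2^-1))).
have -> : X (constf M 2^-1 * l) = constf M 2^-1 * X l.
  by rewrite -[_ * l]addr0 vfL vf0 addr0.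
have half a : constf M 2^-1 * (a + a) = a.
  apply/val_inj/funext => p; change (2^-1 * (a p + a p) = a p); lra.
by rewrite half => ->; ring.
Qed.

End SmoothOnManifold.

(** * Global frames *)

(** Vectors without a common nonzero annihilator span the space; independent ones are chosen one at
    a time. *)
Lemma row_free_rows (F : fieldType) (T : Type) m (L : T -> 'rV[F]_m) r :
  (forall c : 'cV[F]_m, (forall t, L t *m c = 0) -> c = 0) -> (r <= m)%N ->
  exists fs : 'I_r -> T, row_free (\matrix_(j < r) L (fs j)).
Proof.
move=> L0; elim: r => [_|r IH rm].
  exists (fun j : 'I_0 => False_rect T (notF (ltn_ord j))).
  by apply: inj_row_free => v _; apply/rowP => -[].
have [fs fsfree] := IH (ltnW rm).
set B := \matrix_(j < r) L (fs j) in fsfree.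
(* Fewer than [m] rows have a nonzero common annihilator [c], found among the columns of the
   cokernel; the next vector is one that does not annihilate [c]. *)
have [c [c0 Bc]] : exists c : 'cV[F]_m, c != 0 /\ B *m c = 0.
  have : cokermx B != 0.
    by rewrite -mxrank_eq0 mxrank_coker (eqP fsfree) subn_eq0 -ltnNge.
  move=> /eqP nz; have [k kP] : exists k, col k (cokermx B) != 0.
    apply: contrapT => h; apply: nz; apply/matrixP => i k.
    have hk : col k (cokermx B) = 0.
      by apply/eqP; apply: contrapT => /negP hk; apply: h; exists k.
    by have := congr1 (fun u : 'cV_m => u i 0) hk; rewrite !mxE.
  by exists (col k (cokermx B)); split=> //; rewrite colE mulmxA mulmx_coker mul0mx.
have [t Ltc] : exists t, L t *m c != 0.
  apply: contrapT => h; move/eqP: c0; apply; apply: L0 => t.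
  by apply/eqP; apply: contrapT => /negP hk; apply: h; exists t.
pose fs' (j : 'I_r.+1) := if unlift ord_max j is Some j' then fs j' else t.
exists fs'; apply: inj_row_free => v.
rewrite mulmx_sum_row big_ord_recr /= rowK /fs' unlift_none.
have -> : \sum_(i < r) v 0 (widen_ord (leqnSn r) i) *:
    row (widen_ord (leqnSn r) i) (\matrix_j L (fs' j)) =
    (\row_(i < r) v 0 (widen_ord (leqnSn r) i)) *m B.
  rewrite mulmx_sum_row; apply: eq_bigr => i _; rewrite !rowK mxE /fs'.
  have -> : widen_ord (leqnSn r) i = lift ord_max i.
    by apply/val_inj/esym; exact: lift_max.
  by rewrite liftK.
(* Multiplying by [c] kills the old rows and isolates the coefficient of the new one. *)
move=> vB; have vmax : v 0 ord_max = 0.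
  have := congr1 (mulmx^~ c) vB; rewrite mulmxDl -mulmxA Bc mulmx0 add0r mul0mx.
  by rewrite -scalemxAl => /eqP; rewrite scaler_eq0 (negbTE Ltc) orbF => /eqP.
move: vB; rewrite vmax scale0r addr0 => /eqP.
rewrite mulmx_free_eq0// => /eqP v0; apply/rowP => j; rewrite mxE.
case: (unliftP ord_max j) => [j'|] -> //.
have := congr1 (fun w : 'rV_r => w 0 j') v0; rewrite !mxE => <-.
by congr (v 0 _); apply/val_inj; exact: lift_max.
Qed.

(** A basis of the module with its coordinate forms; for vector fields, the coordinates are thereby
    smooth functions. *)
Definition dual_frame (C : comPzRingType) (V : lmodType C) r
    (E : 'I_r -> V) (e : 'I_r -> dual V) : Prop :=
  (forall v, v = \sum_i (e i v : C) *: E i) /\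
  (forall i j, e i (E j) = (i == j)%:R :> C).

Section Frame.
Variables (R : realType) (m : nat) (M : smoothManifold R m).
Local Notation C := (smoothFun M).

(** A ring morphism to the field [R], through which determinants and adjugates over [C] are
    evaluated at a point. *)
Definition eval_at (q : M) (f : C) : R := f q.

Fact eval_at_zmod q : zmod_morphism (eval_at q). Proof. by []. Qed.
Fact eval_at_monoid q : monoid_morphism (eval_at q). Proof. by []. Qed.

HB.instance Definition _ q :=
  GRing.isZmodMorphism.Build C R (eval_at q) (eval_at_zmod q).
HB.instance Definition _ q :=
  GRing.isMonoidMorphism.Build C R (eval_at q) (eval_at_monoid q).

Lemma vf_sumE I (r : seq I) (X : I -> vfield M) f :
  (\sum_(i <- r) X i) f = \sum_(i <- r) X i f.
Proof. exact: (big_morph (fun Y : vfield M => Y f) (fun _ _ => erefl) erefl). Qed.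

(** Parallelizability gives unique coefficients at each point. Their smoothness comes from Cramer's
    rule for the system X(f_j) = sum_k c_k E_k(f_j), with functions f_j that make it regular at the
    given point; their linearity in [X] comes from uniqueness. *)
Lemma parallelizable_frame : parallelizable M ->
  exists (E : 'I_m -> vfield M) (e : 'I_m -> dual (vfield M)), dual_frame E e.
Proof.
move=> [E EP].
have tv (Z : vfield M) p : @tangent_vector R m M p (fun f => Z f p).
  split=> [r f g|f g]; rewrite ?vfL ?vfM //.
have cex (X : vfield M) : exists c : M -> 'I_m -> R,
    forall p f, X f p = \sum_i c p i * E i f p.
  have /choice[c cP] : forall p, exists c : 'I_m -> R,
      forall f, X f p = \sum_i c i * E i f p.
    by move=> p; have [c [cP _]] := EP p _ (tv X p); exists c.
  by exists c.
have /choice[c cP] := cex.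
have sumE (d : 'I_m -> C) f p : (\sum_i d i *: E i) f p = \sum_i d i p * E i f p.
  by rewrite vf_sumE -[LHS]/(eval_at p _) raddf_sum.
have cuniq p (a b : 'I_m -> R) :
    (forall f, \sum_i a i * E i f p = \sum_i b i * E i f p) -> a = b.
  move=> ab; pose X := \sum_i constf M (a i) *: E i.
  have [d [_ dP]] := EP p _ (tv X p).
  rewrite -(dP a) => [|f]; last by rewrite sumE.
  by apply: dP => f; rewrite sumE /= ab.
have csm X i : (fun p => c X p i) \in @smooth R m M.
  apply: smooth_quotient => p.
  (* Coefficients annihilated by every row of values [E i f p] vanish by [cuniq], so [m] of these
     rows are independent. *)
  have [|fs fsfree] := @row_free_rows R C m (fun f => \row_i E i f p) m _ (leqnn m).
    move=> a a0; apply/colP => k; rewrite mxE.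
    have : (fun i => a i 0) = (fun=> 0).
      apply: (cuniq p) => f; rewrite [RHS]big1 => [|? _]; last by rewrite mul0r.
      have := congr1 (fun u : 'M_1 => u 0 0) (a0 f); rewrite !mxE.
      apply: etrans; by apply: eq_bigr => j _; rewrite mxE mulrC.
    by move=> /(congr1 (fun u : 'I_m -> R => u k)).
  pose D : 'M[C]_m := \matrix_(j, k) E k (fs j).
  pose Y : 'cV[C]_m := \col_j X (fs j).
  exists (\det D), ((\adj D *m Y) i 0); split.
    rewrite -[_ p]/(eval_at p _) -det_map_mx -unitfE -/(_ \in unitmx).
    move: fsfree; rewrite row_free_unit; congr (is_true (_ \in unitmx)).
    by apply/matrixP => j k; rewrite !mxE.
  (* The identity adj(D) Y = det(D) c holds at every [q], also where the determinant vanishes, as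
     [smooth_quotient] asks. *)
  move=> q.
  change (c X q i * eval_at q (\det D) = eval_at q ((\adj D *m Y) i 0)).
  have YE : map_mx (eval_at q) Y = map_mx (eval_at q) D *m \col_k c X q k.
    apply/colP => j; rewrite !mxE /eval_at cP.
    by apply: eq_bigr => k _; rewrite !mxE mulrC.
  have -> : eval_at q ((\adj D *m Y) i 0) = (map_mx (eval_at q) (\adj D *m Y)) i 0.
    by rewrite [RHS]mxE.
  rewrite map_mxM map_mx_adj YE mulmxA mul_adj_mx mul_scalar_mx !mxE det_map_mx.
  exact: mulrC.
pose e0 i (X : vfield M) : C^o := SmoothFun (csm X i).
have elin i : e0 i \in @linearp C (vfield M) C^o.
  apply/asboolP => a X Y; apply/val_inj/funext => p.
  suff /(congr1 (fun u : 'I_m -> R => u i)) : c (a *: X + Y) p =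
    (fun j => a p * c X p j + c Y p j) by [].
  apply: (cuniq p) => f; rewrite -cP.
  change (a p * X f p + Y f p = \sum_j (a p * c X p j + c Y p j) * E j f p).
  rewrite !cP mulr_sumr -big_split; apply: eq_bigr => j _ /=.
  by rewrite mulrDl mulrA.
exists E, (fun i => Lmap (elin i)); split=> [X|i j].
  by apply: vf_ext => f; apply/val_inj/funext => p; rewrite /= sumE cP.
apply/val_inj/funext => p /=.
have -> : c (E j) p = fun k => (k == j)%:R.
  apply: (cuniq p) => f; rewrite -cP (bigD1 j)//= eqxx mul1r big1 ?addr0//.
  by move=> k /negbTE ->; rewrite mul0r.
by case: eqP.
Qed.

End Frame.

(** * Alternating forms on a free module *)

Section AltForms.
Variables (C : comPzRingType) (V : lmodType C).

Lemma alt_sum k (w : altForm V k) v i I (r : seq I) (c : I -> C) (x : I -> V) :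
  w (upd v i (\sum_(l <- r) c l *: x l)) = \sum_(l <- r) c l * w (upd v i (x l))
    :> C.
Proof.
elim/big_rec2: _ => [|l s y _ IH]; first exact: alt0.
by rewrite altD altZ IH.
Qed.

(** Transpositions only change signs; with vanishing as the claim, the sign of [s] need not be
    tracked. *)
Lemma alt_perm_eq0 k (w : altForm V k) v (s : 'S_k) : w v = 0 -> w (v \o s) = 0.
Proof.
have [ts -> _] := prod_tpermP s; elim: ts v => [|t ts IH] v wv.
  rewrite big_nil (_ : v \o _ = v)//.
  by apply/funext => i /=; rewrite perm1.
rewrite big_cons (_ : v \o _ = (v \o \prod_(u <- ts) tperm u.1 u.2)%g \o tperm t.1 t.2).
  have [<-|t12] := eqVneq t.1 t.2.
    rewrite (_ : _ \o _ = v \o (\prod_(u <- ts) tperm u.1 u.2)%g) ?IH//.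
    by apply/funext => i /=; rewrite tperm1 perm1.
  rewrite swap_upd; set u := v \o _.
  have := alt_skew w u (u t.2) (u t.1) t12; rewrite !upd_id.
  by rewrite /u IH// addr0.
by apply/funext => i /=; rewrite permM.
Qed.

Fact detform_subproof k (b : 'I_k -> dual V) :
  (fun v => \det (\matrix_(i, j) b j (v i))) \in @alternatingp C V k.
Proof.
apply/asboolP; split=> [v i a x y|v i j ij vij].
- rewrite -[X in _ = _ + X]mul1r; apply: (determinant_multilinear (i0 := i)).
  + by apply/rowP => j; rewrite !mxE !upd_same linearP mul1r.
  + by apply/matrixP => l j; rewrite !mxE !upd_neq// eq_sym neq_lift.
  + by apply/matrixP => l j; rewrite !mxE !upd_neq// eq_sym neq_lift.
- by apply: (determinant_alternate ij) => l; rewrite !mxE vij.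
Qed.

(** The form b_0 /\ ... /\ b_(k-1). *)
Definition detform k (b : 'I_k -> dual V) : altForm V k :=
  AltForm (detform_subproof b).

End AltForms.

(** * Forms evaluated on a frame, and top forms *)

Section DualFrame.
Variables (C : comPzRingType) (V : lmodType C) (m : nat).
Variables (E : 'I_m -> V) (e : 'I_m -> dual V).
Hypothesis Ee : dual_frame E e.

Let span v : v = \sum_i (e i v : C) *: E i. Proof. by case: Ee. Qed.
Let dualE i j : e i (E j) = (i == j)%:R :> C. Proof. by case: Ee. Qed.

(** Multilinear expansion in the frame, one slot after the other; a repeated frame vector gives
    zero. *)
Lemma frame_alt_eq0 k (w : altForm V k) :
  (forall f : 'I_k -> 'I_m, injective f -> w (E \o f) = 0) -> w = 0.
Proof.
move=> winj; have wE f : w (E \o f) = 0.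
  have [/injectiveP/winj//|/injectivePn[i [j ij fij]]] := boolP (injectiveb f).
  by apply: (alt_eq0 w ij); rewrite /= fij.
(* Invariant: the slots from [r] on already hold frame vectors. At [r = k] this is no condition, at
   [r = 0] it covers all slots. *)
suff H r v : (r <= k)%N ->
    (forall i : 'I_k, (r <= i)%N -> exists l, v i = E l) -> w v = 0.
  by apply: alt_ext => v; apply: (H k) => // i; rewrite leqNgt ltn_ord.
elim: r v => [|r IH] v rk vE.
  have /choice[f vf] : forall i, exists l, v i = E l by move=> i; exact: vE.
  by rewrite (_ : v = E \o f) ?wE//; exact/funext.
rewrite -(upd_id v (Ordinal rk)) (span (v _)) alt_sum big1// => l _.
rewrite IH ?mulr0// 1?ltnW// => i; rewrite leq_eqVlt => /orP[/eqP ri|ri].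
  have -> : i = Ordinal rk by exact: val_inj.
  by exists l; rewrite upd_same.
rewrite upd_neq; first exact: vE.
by rewrite -val_eqE /= gtn_eqF.
Qed.

Lemma frame_top_eq0 (w : altForm V m) : w E = 0 -> w = 0.
Proof.
move=> wE; apply: frame_alt_eq0 => f finj.
rewrite (_ : E \o f = E \o perm finj); first exact: alt_perm_eq0.
by apply/funext => i /=; rewrite permE.
Qed.

Definition frame_volume : altForm V m := detform e.

Lemma frame_volume1 : frame_volume E = 1 :> C.
Proof.
rewrite /= -[RHS](det1 _ m); congr (\det _); apply/matrixP => i j.
by rewrite !mxE dualE eq_sym.
Qed.

Lemma top_formE (w : altForm V m) : w = (w E : C) *: frame_volume.
Proof.
apply/eqP; rewrite -subr_eq0; apply/eqP/frame_top_eq0.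
by rewrite altDE altNE altZE frame_volume1 mulr1 subrr.
Qed.

(** Summed over [i], this turns the bracket terms in the Lie derivative of a top form into a trace,
    both for the tangent bundle and for the algebroid. *)
Lemma top_form_upd (w : altForm V m) i x : w (upd E i x) = (e i x : C) * w E.
Proof.
rewrite {1}(span x) alt_sum (bigD1 i)//= upd_id big1 ?addr0// => l li.
by rewrite (alt_eq0 w li) ?mulr0// upd_same upd_neq.
Qed.

End DualFrame.

(** * Forms of degree one less than the rank, identified with vectors *)

Section Codimension1.
Variables (C : comPzRingType) (V : lmodType C) (n : nat).
Variables (E : 'I_n.+1 -> V) (e : 'I_n.+1 -> dual V).
Hypothesis Ee : dual_frame E e.
Local Notation omega := (frame_volume e).

Let span v : v = \sum_i (e i v : C) *: E i. Proof. by case: Ee. Qed.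
Let dualE i j : e i (E j) = (i == j)%:R :> C. Proof. by case: Ee. Qed.

(** An injective choice of [n] indices among [n + 1] omits some [i], hence is [lift i] up to a
    permutation. *)
Lemma frame_codim1_eq0 (w : altForm V n) :
  (forall i, w (E \o lift i) = 0) -> w = 0.
Proof.
move=> wE; apply: (frame_alt_eq0 Ee) => f finj.
have [i fi] : exists i, forall j, f j != i.
  apply: contrapT => h; suff : (n.+1 <= n)%N by rewrite ltnn.
  have fsurj i : exists j, f j = i.
    apply: contrapT => hi; apply: h; exists i => j; apply/eqP => fji.
    by apply: hi; exists j.
  have /choice[g fg] := fsurj.
  by have := leq_card g (can_inj fg); rewrite !card_ord.
have /choice[g fg] : forall j, exists j', f j = lift i j'.
  move=> j; case: (unliftP i (f j)) => [j' ->|/eqP]; first by exists j'.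
  by rewrite (negbTE (fi j)).
have ginj : injective g.
  by move=> j j' gjj'; apply: finj; rewrite !fg gjj'.
rewrite (_ : E \o f = (E \o lift i) \o perm ginj); first exact: alt_perm_eq0.
by apply/funext => j /=; rewrite permE fg.
Qed.

(* The vector corresponding to w under the pairing of n-forms with 1-forms; see
   [wedge1_contraction]. *)
Definition frame_contraction (w : altForm V n) : V :=
  \sum_(l < n.+1) ((-1) ^+ (n - l) * w (E \o lift l) : C) *: E l.

Lemma frame_contraction_coord w i :
  e i (frame_contraction w) = (-1) ^+ (n - i) * w (E \o lift i) :> C.
Proof.
rewrite /frame_contraction linear_sum (bigD1 i)//= big1 ?addr0 => [|l li].
  by rewrite linearZ /= dualE eqxx; exact: mulr1.
by rewrite linearZ /= dualE eq_sym (negbTE li); exact: mulr0.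
Qed.

Lemma frame_contraction_linear a (w w' : altForm V n) :
  frame_contraction (a *: w + w') = a *: frame_contraction w + frame_contraction w'.
Proof.
rewrite /frame_contraction scaler_sumr -big_split /=.
apply: eq_bigr => l _; rewrite scalerA -scalerDl; congr (_ *: _).
change ((-1) ^+ (n - l) * (a * w (E \o lift l) + w' (E \o lift l)) =
  a * ((-1) ^+ (n - l) * w (E \o lift l)) + (-1) ^+ (n - l) * w' (E \o lift l)).
by ring.
Qed.

Lemma frame_contractionD (w w' : altForm V n) :
  frame_contraction (w + w') = frame_contraction w + frame_contraction w'.
Proof. by rewrite -[w in LHS]scale1r frame_contraction_linear scale1r. Qed.

Lemma frame_contraction0 : frame_contraction 0 = 0.
Proof. by apply: (addIr (frame_contraction 0)); rewrite -frame_contractionD !add0r. Qed.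

Lemma frame_contractionZ a (w : altForm V n) :
  frame_contraction (a *: w) = a *: frame_contraction w.
Proof.
by rewrite -[_ *: w]addr0 frame_contraction_linear frame_contraction0 addr0.
Qed.

Lemma frame_contraction_inj : injective frame_contraction.
Proof.
move=> w w' cww'; apply/eqP; rewrite -subr_eq0; apply/eqP/frame_codim1_eq0 => i.
rewrite altDE altNE; apply/eqP; rewrite subr_eq0; apply/eqP.
have := congr1 (e i) cww'; rewrite !frame_contraction_coord.
move=> /(congr1 ( *%R ((-1) ^+ (n - i)))).
by rewrite !mulrA -!expr2 !sqrr_sign !mul1r.
Qed.

(** This is [omega] with [v] inserted in the last slot, the inverse of [frame_contraction]. *)
Definition codim1_form (v : V) : altForm V n :=
  \sum_(i < n.+1) ((-1) ^+ (n - i) * e i v : C) *: detform (e \o lift i).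

Lemma detform_lift i l : detform (e \o lift i) (E \o lift l) = (i == l)%:R :> C.
Proof.
have [<-|il] := eqVneq i l.
  rewrite -[RHS](det1 _ n); congr (\det _); apply/matrixP => a b.
  by rewrite !mxE /= dualE (inj_eq lift_inj) eq_sym.
case: (unliftP i l) => [k|] lE; last by rewrite lE eqxx in il.
(* Column [k] belongs to the covector [e l], which vanishes on every frame vector but [E l]. *)
rewrite /= (expand_det_col _ k) big1// => j _.
by rewrite mxE /= dualE -lE (negbTE (neq_lift l j)) mul0r.
Qed.

Lemma codim1_formK : cancel codim1_form frame_contraction.
Proof.
move=> v; rewrite [RHS]span; apply: eq_bigr => l _; congr (_ *: _).
have sumE I (r : seq I) (w : I -> altForm V n) u :
    (\sum_(i <- r) w i) u = \sum_(i <- r) w i u.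
  exact: (big_morph (fun w : altForm V n => w u) (fun _ _ => erefl) erefl).
rewrite sumE (eq_bigr (fun i : 'I_n.+1 =>
    (-1) ^+ (n - i) * e i v * (i == l)%:R)) => [|i _]; last first.
  by rewrite -detform_lift.
rewrite (bigD1 l)//= big1 => [|i il]; last by rewrite (negbTE il) mulr0.
by rewrite eqxx mulr1 addr0 mulrA -expr2 sqrr_sign mul1r.
Qed.

(** The signs in [frame_contraction] are those of [wedge1], so both sides agree on the frame. *)
Lemma wedge1_contraction w (b : dual V) :
  wedge1 w b = (b (frame_contraction w) : C) *: omega.
Proof.
rewrite [LHS](top_formE Ee); congr (_ *: _).
rewrite /= /wedge1_fun /frame_contraction linear_sum; apply: eq_bigr => l _.
by rewrite linearZ /= /GRing.scale/= mulrA.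
Qed.

(* Both sides compute (w /\ e_i)(u) for u = (E_0, .., z, .., E_n) with z at l. *)
Lemma codim1_upd (w : altForm V n) i j z (l := lift i j) :
  (-1) ^+ (n - i) * w (upd (E \o lift i) j z) =
  (e i (frame_contraction w) : C) * e l z - (e l (frame_contraction w) : C) * e i z :> C.
Proof.
have il : i != l := neq_lift i j.
have := congr1 (fun W : altForm V n.+1 => W (upd E l z)) (wedge1_contraction w (e i)).
rewrite altZE (top_form_upd Ee omega) (frame_volume1 Ee) mulr1 => <-.
rewrite /= /wedge1_fun (bigD1 i)//= (bigD1 l) 1?eq_sym//= [X in _ + (_ + X)]big1.
  rewrite addr0 upd_lift_neq upd_lift upd_same upd_neq// dualE eqxx.
  by rewrite frame_contraction_coord -[bump i j]/(l : nat) /=; ring.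
move=> p /andP[pi pl]; rewrite upd_neq// dualE eq_sym (negbTE pi).
by rewrite mulr0 mulr0.
Qed.

End Codimension1.

(** * The Nambu-Poisson algebroid in a frame *)

Lemma sign_subn (A : comPzRingType) k i :
  (i <= k)%N -> (-1) ^+ i = (-1) ^+ k * (-1) ^+ (k - i) :> A.
Proof. by move=> ik; rewrite -{1}(subnK ik) exprD mulrAC -expr2 sqrr_sign mul1r. Qed.

Section FrameCalculus.
Variables (R : realType) (n : nat) (M : smoothManifold R n.+1).
Local Notation C := (smoothFun M).
Local Notation T := (tangentAlgebroid M).
Local Notation V := (vfield M).
Variables (E : 'I_n.+1 -> V) (e : 'I_n.+1 -> dual V).
Hypothesis Ee : dual_frame E e.
Local Notation omega := (frame_volume e).
Local Notation kappa := (frame_contraction E).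
Implicit Types (X Y Z : V) (f g : C) (al be : diffForm M n).

Let dualE i j : e i (E j) = (i == j)%:R :> C. Proof. by case: Ee. Qed.
Let span X : X = \sum_i (e i X : C) *: E i. Proof. by case: Ee. Qed.

Lemma lie_bracketZl f X Y : lie_bracket (f *: X) Y = f *: lie_bracket X Y - Y f *: X.
Proof. exact: (la_brZl T). Qed.

(** The divergence relative to [omega], see [lieD_volume]. The trace of [X, -] is taken in the frame
    and depends on it, as [X, -] is not linear over functions. *)
Definition divergence X : C := - \sum_i (e i (lie_bracket X (E i)) : C).

Lemma lieD_volume X : lieD T X omega = divergence X *: omega.
Proof.
rewrite [LHS](top_formE Ee); congr (_ *: _); rewrite /= /lieD_fun.
have -> : (anchor T X) (omega E) = 0 by rewrite (frame_volume1 Ee) -constf1 vf_cst.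
rewrite sub0r; congr (- _); apply: eq_bigr => i _.
by rewrite (top_form_upd Ee) (frame_volume1 Ee) mulr1.
Qed.

Lemma divergenceZ f X : divergence (f *: X) = f * divergence X + X f.
Proof.
rewrite /divergence mulrN mulr_sumr.
have -> : X f = \sum_i (e i X : C) * E i f.
  rewrite {1}(span X) vf_sumE; apply: eq_bigr => i _; exact: vfZE.
rewrite -[RHS]opprK opprD opprK -sumrB; congr (- _).
apply: eq_bigr => i _; rewrite lie_bracketZl linearB !linearZ /=.
by rewrite /GRing.scale /=; ring.
Qed.

Lemma vf_sign X k f : X ((-1) ^+ k * f) = (-1) ^+ k * X f.
Proof.
by elim: k => [|k IH]; rewrite ?expr0 ?mul1r// exprS !mulN1r !mulNr vfN IH.
Qed.

Lemma lieD_wedge1 X al f :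
  lieD T X (wedge1 al (dfun f)) =
  wedge1 (lieD T X al) (dfun f) + wedge1 al (dfun (X f)).
Proof.
apply: alt_ext => v; rewrite altDE /= /lieD_fun /= /wedge1_fun.
have X_sum I (r : seq I) (F : I -> C) :
    X (\sum_(i <- r) F i) = \sum_(i <- r) X (F i).
  by apply: (big_morph X); [exact: vfD|exact: vf0].
rewrite X_sum exchange_big -sumrB -big_split; apply: eq_bigr => i _ /=.
rewrite vf_sign -mulr_sumr -mulrBr -mulrDr; congr (_ * _).
(* Slot [i] of the bracket sum meets [df], where X(v_i f) - [X, v_i] f = v_i (X f); the other slots
   belong to the Lie derivative of [al]. *)
rewrite vfM (bigD1_ord i)//= upd_lift upd_same lie_bracketE.
under eq_bigr => j _.
  rewrite upd_lift_neq upd_neq ?neq_lift//.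
  over.
rewrite -mulr_suml /lieD_fun /=.
set S := \sum_j _.
by ring.
Qed.

(** The Lie derivative is applied to al /\ df = kappa(al)(f) omega, and the coefficients of [omega]
    are compared. *)
Lemma frame_contraction_lieD X al :
  kappa (lieD T X al) = lie_bracket X (kappa al) + divergence X *: kappa al.
Proof.
apply: vf_ext => f.
have E1 be g : wedge1 be (dfun g) = (kappa be g : C) *: omega.
  exact: (wedge1_contraction Ee be (dfun g)).
have := lieD_wedge1 X al f; rewrite !E1.
have -> : lieD T X ((kappa al f : C) *: omega) =
    (kappa al f * divergence X + X (kappa al f)) *: omega.
  have := lieD_linear T X omega 0 (kappa al f); rewrite !addr0 lieD0 addr0 => ->.
  by rewrite lieD_volume scalerA scalerDl.
move=> /(congr1 (fun w : diffForm M n.+1 => w E : C)).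
rewrite altDE !altZE (frame_volume1 Ee) !mulr1 => h.
rewrite vfDE vfZE lie_bracketE; apply: (addIr (kappa al (X f))).
by rewrite -h; ring.
Qed.

(** On the frame both sides are sums over index pairs: the differential over i < l, the divergence
    over all i and l. *)
Lemma dext_contraction al :
  dext T al = ((-1) ^+ n * divergence (kappa al)) *: omega.
Proof.
rewrite [LHS](top_formE Ee); congr (_ *: _).
pose c i : C := e i (kappa al).
pose A i l : C := c i * e l (lie_bracket (E i) (E l)).
(* Expansion of kappa(al) = sum_l c_l E_l: the derivatives of the coefficients give sum_i E_i(c_i),
   the remaining terms involve the structure functions e_l([E_i, E_l]). *)
have divE : divergence (kappa al) = \sum_i (E i (c i) - \sum_l A i l).
  rewrite sumrB exchange_big -sumrB /divergence -sumrN /=; apply: eq_bigr => i _.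
  rewrite [kappa al]span -/(c _).
  have -> : lie_bracket (\sum_l c l *: E l) (E i) =
      \sum_l (c l *: lie_bracket (E l) (E i) - E i (c l) *: E l).
    rewrite (big_morph (fun Z => lie_bracket Z (E i)) (id1 := 0) (op1 := +%R)).
    - by apply: eq_bigr => l _; exact: lie_bracketZl.
    - by move=> ? ?; exact: tangent_brDl.
    - by apply: vf_ext => f; rewrite lie_bracketE !vf0E vf0 subr0.
  rewrite linear_sum /= -[RHS]opprB; congr (- _).
  have -> : E i (c i) = \sum_l E i (c l) * e i (E l).
    rewrite (bigD1 i)//= dualE eqxx mulr1 big1 ?addr0// => l li.
    by rewrite dualE eq_sym (negbTE li) mulr0.
  rewrite -sumrB; apply: eq_bigr => l _.
  by rewrite linearB !linearZ.
have ord_gt (F : 'I_n.+1 -> C) (i : 'I_n.+1) :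
    \sum_(j < n | (i <= j)%N) F (lift i j) = \sum_(l < n.+1 | (i < l)%N) F l.
  rewrite [RHS]big_mkcond (bigD1_ord i)//= ltnn add0r [LHS]big_mkcond.
  apply: eq_bigr => j _; congr (if _ then _ else _); rewrite /= /bump.
  by case: leqP => ij /=; lia.
(* The double sum folds onto pairs i < l, its diagonal being zero; [codim1_upd] produces the same
   pairs A_il + A_li. *)
have pairs : \sum_(i < n.+1) \sum_(l < n.+1 | (i < l)%N) (A i l + A l i) =
    \sum_i \sum_l A i l.
  under eq_bigr => i _ do rewrite big_split.
  rewrite big_split /= [X in _ + X](exchange_big_dep xpredT)//= -big_split.
  apply: eq_bigr => i _ /=.
  have Aii : A i i = 0 by rewrite /A tangent_brxx linear0 mulr0.
  rewrite [RHS](bigID (fun l : 'I__ => (i < l)%N)) /=; congr (_ + _).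
  rewrite [RHS](bigD1 i) ?ltnn//= Aii add0r.
  by apply: eq_bigl => l; rewrite -leqNgt ltn_neqAle andbC.
rewrite divE sumrB -pairs -sumrB mulr_sumr /= /dext_fun.
apply: eq_bigr => i _.
have -> : (-1) ^+ i = (-1) ^+ n * (-1) ^+ (n - i) :> C.
  by apply: sign_subn; rewrite -ltnS.
rewrite -mulrA mulrBr -vf_sign -(frame_contraction_coord Ee) -/(c i).
congr (_ * (_ - _)); rewrite -ord_gt mulr_sumr; apply: eq_bigr => j _.
rewrite (codim1_upd Ee) -/(c i) -/(c _) /A.
by rewrite -[lie_bracket (E (lift i j)) _]opprK -(la_brN T) linearN mulrN.
Qed.

(** * The Nambu-Poisson bracket carried over to vector fields *)

Section Bracket.
Variable P : multivector M n.+1.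
Local Notation pi := (P omega : C).

Lemma sharp_contraction al : sharp P al = pi *: kappa al.
Proof.
apply: vf_ext => f; rewrite vfZE /= (wedge1_contraction Ee) linearZ /=.
exact: mulrC.
Qed.

Lemma multivector_dext al :
  (-1) ^+ n.+1 * P (dext T al) = - (divergence (kappa al) * pi) :> C.
Proof.
rewrite dext_contraction linearZ /= exprS mulN1r mulNr.
by congr (- _); rewrite /GRing.scale /= !mulrA -expr2 sqrr_sign mul1r.
Qed.

Definition nambu_bracket al be : diffForm M n :=
  lieD T (sharp P al) be + ((-1) ^+ n.+1 * P (dext T al)) *: be.

Definition contracted_bracket X Y : V := lie_bracket (pi *: X) Y + X pi *: Y.

(** With X = kappa(al), the coefficient of kappa(be) is div(pi X) - pi div(X) = X(pi). *)
Lemma frame_contraction_nambu_bracket al be :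
  kappa (nambu_bracket al be) = contracted_bracket (kappa al) (kappa be).
Proof.
rewrite /nambu_bracket addrC frame_contraction_linear frame_contraction_lieD.
rewrite multivector_dext sharp_contraction divergenceZ addrCA -scalerDl; congr (_ + _ *: _).
by ring.
Qed.

Lemma contracted_bracketE X Y f :
  contracted_bracket X Y f = pi * X (Y f) - Y pi * X f - pi * Y (X f) + X pi * Y f.
Proof.
rewrite /contracted_bracket vfDE lie_bracketE !vfZE vfM; ring.
Qed.

(** Carried over by kappa, the anchor is multiplication by [pi]; this is its compatibility with
    brackets. *)
Lemma contracted_bracket_anchor X Y :
  pi *: contracted_bracket X Y = lie_bracket (pi *: X) (pi *: Y).
Proof.
apply: vf_ext => f; rewrite vfZE contracted_bracketE lie_bracketE !vfZE !vfM; ring.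
Qed.

Lemma sharp_linear : linear (sharp P).
Proof.
move=> a al be; rewrite !sharp_contraction frame_contraction_linear scalerDr.
by rewrite !scalerA mulrC.
Qed.

(** As kappa is injective, the axioms of the bracket become identities for [contracted_bracket],
    checked on functions. *)
Lemma nambu_algebroid_exists :
  exists A : lieAlgebroid (diffForm M n), is_nambu_algebroid P A.
Proof.
pose rhoL := GRing.isLinear.Build C (diffForm M n) V *:%R (sharp P) sharp_linear.
pose rho : {linear diffForm M n -> V} := HB.pack (sharp P) rhoL.
have kD := frame_contractionD E.
have kZ := frame_contractionZ E.
have kI := @frame_contraction_inj _ _ _ _ _ Ee.
have brDl al be ga :
    nambu_bracket (al + be) ga = nambu_bracket al ga + nambu_bracket be ga.
  apply: kI; rewrite [RHS]kD !frame_contraction_nambu_bracket kD; apply: vf_ext => f.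
  by rewrite [RHS]vfDE !contracted_bracketE !vfDE vfD; ring.
have brDr al be ga :
    nambu_bracket al (be + ga) = nambu_bracket al be + nambu_bracket al ga.
  apply: kI; rewrite [RHS]kD !frame_contraction_nambu_bracket kD; apply: vf_ext => f.
  by rewrite [RHS]vfDE !contracted_bracketE !vfDE vfD; ring.
have brxx al : nambu_bracket al al = 0.
  apply: kI; rewrite frame_contraction_nambu_bracket frame_contraction0.
  apply: vf_ext => f.
  by rewrite contracted_bracketE vf0E; ring.
have jac al be ga : nambu_bracket al (nambu_bracket be ga) =
    nambu_bracket (nambu_bracket al be) ga + nambu_bracket be (nambu_bracket al ga).
  apply: kI; rewrite [RHS]kD !frame_contraction_nambu_bracket; apply: vf_ext => f.
  by rewrite [RHS]vfDE !(contracted_bracketE, vfD, vfN, vfM); ring.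
have brZr al f be : nambu_bracket al (f *: be) =
    f *: nambu_bracket al be + rho al f *: be.
  apply: kI; rewrite [RHS]kD !kZ !frame_contraction_nambu_bracket kZ; apply: vf_ext => g.
  have -> : rho al f = pi * kappa al f by rewrite -vfZE -sharp_contraction.
  by rewrite [RHS]vfDE !vfZE !contracted_bracketE !vfZE !vfM; ring.
have anc al be : rho (nambu_bracket al be) = lie_bracket (rho al) (rho be).
  rewrite -[LHS]/(sharp P _) -[rho al]/(sharp P _) -[rho be]/(sharp P _).
  by rewrite !sharp_contraction frame_contraction_nambu_bracket contracted_bracket_anchor.
by exists (@LieAlgebroid _ _ _ _ rho nambu_bracket brDl brDr brxx jac brZr anc).
Qed.

End Bracket.
End FrameCalculus.

(** * Modular classes *)

Section NambuModularClasses.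
Variables (R : realType) (n : nat) (M : smoothManifold R n.+1).
Local Notation C := (smoothFun M).
Local Notation T := (tangentAlgebroid M).
Local Notation V := (vfield M).
Variables (E : 'I_n.+1 -> V) (e : 'I_n.+1 -> dual V).
Hypothesis Ee : dual_frame E e.
Local Notation omega := (frame_volume e).
Local Notation kappa := (frame_contraction E).
Variables (P : multivector M n.+1) (A : lieAlgebroid (diffForm M n)).
Hypothesis nambuA : is_nambu_algebroid P A.
Local Notation pi := (P omega : C).
Implicit Types al be : diffForm M n.

Let anchorE al : anchor A al = pi *: kappa al.
Proof. by rewrite (proj1 nambuA) (sharp_contraction Ee). Qed.

Let bracketE al be :
  kappa (la_br A al be) = contracted_bracket e P (kappa al) (kappa be).
Proof.
by rewrite -(frame_contraction_nambu_bracket Ee) (proj2 nambuA).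
Qed.

Fact modular_cochain_subproof :
  (fun al => kappa al pi) \in @linearp C (diffForm M n) C^o.
Proof.
by apply/asboolP => a al be; rewrite frame_contraction_linear vfDE vfZE.
Qed.

Definition modular_cochain : dual (diffForm M n) := Lmap modular_cochain_subproof.

(** With X = kappa(al) and Y = kappa(be), the terms X(pi) Y(pi) cancel in [contracted_bracketE] at f
    = pi, leaving pi X(Y(pi)) - pi Y(X(pi)). *)
Fact modular_cochain_cocycle : modular_cochain \in cocycle A.
Proof.
apply/asboolP => al be; rewrite /= bracketE contracted_bracketE !anchorE !vfZE.
by ring.
Qed.

Definition modular_cocycle : cocycle1 A := Cocycle1 modular_cochain_cocycle.

Lemma modular_tensor_frame_volume : is_modular_tensor P omega modular_cochain.
Proof.
move=> al; rewrite (sharp_contraction Ee) (lieD_volume Ee) (multivector_dext Ee).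
rewrite (divergenceZ Ee) -scalerDl; congr (_ *: _) => /=; ring.
Qed.

Lemma frame_volume_form : volume_form omega.
Proof. by move=> p; exists E; rewrite (frame_volume1 Ee) oner_neq0. Qed.

(** For eta = g omega the Leibniz rule gives g N = g N_0 + rho(g), where N_0 is the modular cochain
    and rho(g) = g rho(ln|g|); then g cancels. *)
Lemma modular_tensor_class (eta : diffForm M n.+1) (N : cocycle1 A) :
  volume_form eta -> is_modular_tensor P eta N ->
  cohomology_class N = cohomology_class modular_cocycle.
Proof.
move=> eta_vol etaN; pose g : C := eta E.
have etaE : eta = g *: omega := top_formE Ee eta.
have g0 p : g p != 0.
  have [X] := eta_vol p; rewrite etaE altZE.
  by apply: contraNneq => gp; rewrite -[_ p]/(g p * _) gp mul0r.
have [l gl] := exists_ln_abs g0.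
apply/cohomology_class_eq; exists l => al; apply: (smoothFun_mulI g0).
have := etaN al; rewrite etaE.
have := lieD_linear T (sharp P al) omega 0 g; rewrite !addr0 lieD0 addr0 => ->.
pose ev (w : diffForm M n.+1) : C := w E.
move=> /(congr1 ev) h; have /(congr1 ev) := modular_tensor_frame_volume al.
move: h; rewrite /ev !(altDE, altZE) (frame_volume1 Ee) !mulr1 => h h0.
rewrite mulrBr (proj1 nambuA) -gl [g * N al]mulrC h h0; ring.
Qed.

Lemma nambu_modular_class c :
  is_nambu_modular_class P c <-> c = cohomology_class modular_cocycle.
Proof.
split=> [[eta [N [eta_vol etaN ->]]]|->]; first exact: modular_tensor_class etaN.
exists omega, modular_cocycle; split=> //; first exact: frame_volume_form.
exact: modular_tensor_frame_volume.
Qed.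

(** * The Evens-Lu-Weinstein class of the algebroid *)

Local Notation aE := (fun i => codim1_form e (E i)).

Fact coord_contraction_subproof i :
  (fun al => e i (kappa al)) \in @linearp C (diffForm M n) C^o.
Proof. by apply/asboolP => a al be; rewrite frame_contraction_linear linearP. Qed.

Definition algebroid_coord i : dual (diffForm M n) := Lmap (coord_contraction_subproof i).

(** The isomorphism kappa carries the frame of vector fields back to one of the algebroid, which
    thus has rank n + 1. *)
Lemma algebroid_frame : dual_frame aE algebroid_coord.
Proof.
split=> [al|i j]; last by rewrite /= (codim1_formK Ee); case: Ee.
apply: (frame_contraction_inj Ee).
rewrite (big_morph kappa (frame_contractionD E) (frame_contraction0 E)).
rewrite {1}[kappa al](proj1 Ee); apply: eq_bigr => i _.
by rewrite frame_contractionZ (codim1_formK Ee).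
Qed.

(** The section that trivializes Q_A, with value 1 on the dual top form and the frame. *)
Definition Qframe : Qsection (diffForm M n) n.+1 := Qtensor (wedge_sec aE) omega.

(** By [top_form_upd] for the frame of the algebroid, the bracket acts on the top multisection
    through a trace. *)
Lemma gerst_frame al :
  gerst A al (wedge_sec aE) =
  (\sum_i (algebroid_coord i (la_br A al (aE i)) : C)) *: wedge_sec aE.
Proof.
rewrite gerst_wedge; apply: lmap_ext => w.
rewrite lmapZE -[RHS]/(_ * w aE) mulr_suml.
rewrite (big_morph (fun X : multisection (diffForm M n) n.+1 => X w : C)
  (fun _ _ => erefl) erefl).
by apply: eq_bigr => i _; exact: (top_form_upd algebroid_frame).
Qed.

Lemma Qnabla_frame al :
  Qnabla A al Qframe = (modular_cochain al *+ n.+1 : C) *: Qframe.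
Proof.
rewrite Qnabla_tensor gerst_frame anchorE (lieD_volume Ee).
set t : C := \sum_i _; set d := divergence _ _ _.
(* The two traces of [pi X, -] cancel index by index, and each of the n + 1 indices leaves one
   X(pi): this is the factor m of the theorem. *)
have td : t + d = modular_cochain al *+ n.+1.
  have -> : modular_cochain al *+ n.+1 = \sum_(i < n.+1) (modular_cochain al : C).
    by rewrite sumr_const card_ord.
  rewrite /t /d /divergence -sumrB.
  apply: eq_bigr => i _.
  rewrite /= bracketE (codim1_formK Ee) /contracted_bracket linearD linearZ /=.
  by rewrite (proj2 Ee) eqxx addrAC subrr add0r; exact: mulr1.
rewrite -td; apply: lmap_ext => w.
rewrite lmapDE lmapZE scalerDl.
change ((t * w aE) *: omega + (w aE : C) *: (d *: omega) =
  t *: ((w aE : C) *: omega) + d *: ((w aE : C) *: omega)).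
by rewrite !scalerA [_ * d]mulrC.
Qed.

Lemma Qnabla_scale g (S : Qsection (diffForm M n) n.+1) al :
  Qnabla A al (g *: S) = g *: Qnabla A al S + anchor A al g *: S.
Proof.
apply: lmap_ext => w; rewrite lmapDE !lmapZE.
change (lieD T (anchor A al) (g *: S w) - g *: S (lieD A al w) =
  g *: (lieD T (anchor A al) (S w) - S (lieD A al w)) + anchor A al g *: S w).
have := lieD_linear T (anchor A al) (S w) 0 g; rewrite !addr0 lieD0 addr0 => ->.
by rewrite scalerBr addrAC.
Qed.

(** Top forms of the algebroid and of the manifold are each free of rank one, so one value
    determines [S]. *)
Lemma QsectionE (S : Qsection (diffForm M n) n.+1) :
  S = (S (frame_volume algebroid_coord) E : C) *: Qframe.
Proof.
apply: lmap_ext => w.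
have -> : S w = (w aE : C) *: S (frame_volume algebroid_coord).
  by rewrite {1}(top_formE algebroid_frame w) linearZ.
set r : C := S _ E.
have -> : S (frame_volume algebroid_coord) = r *: omega := top_formE Ee _.
rewrite lmapZE; change (Qframe w) with ((w aE : C) *: omega).
by rewrite !scalerA mulrC.
Qed.

Lemma Qframe1 : Qframe (frame_volume algebroid_coord) E = 1 :> C.
Proof.
change ((frame_volume algebroid_coord aE : C) * omega E = 1).
by rewrite (frame_volume1 algebroid_frame) (frame_volume1 Ee) mulr1.
Qed.

Lemma Qsection_scale_inj (S : Qsection (diffForm M n) n.+1) w X (a b : C) :
  S w X = 1 :> C -> a *: S = b *: S -> a = b.
Proof.
move=> SwX /(congr1 (fun S' : Qsection (diffForm M n) n.+1 => S' w X : C)).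
by rewrite !lmapZE !altZE SwX !mulr1.
Qed.

Lemma modular_cocycleMn al k : (modular_cocycle *+ k) al = modular_cochain al *+ k.
Proof. by elim: k => [|k IH] //; rewrite !mulrS -IH. Qed.

(** A nowhere vanishing section is g times [Qframe] with g nowhere zero, and by the Leibniz rule its
    cochain differs from that of [Qframe] by the coboundary of ln|g|. *)
Lemma ELW_modular_class (c : H1 A) :
  is_ELW_modular_class n.+1 c <-> c = cohomology_class (modular_cocycle *+ n.+1).
Proof.
split=> [[s [th [s0 sth ->]]]|->]; last first.
  exists Qframe, (modular_cocycle *+ n.+1); split=> //.
    move=> p; exists (frame_volume algebroid_coord), E.
    by have := congr1 (fun f : C => f p) Qframe1 => /= ->; rewrite oner_neq0.
  by move=> al; rewrite Qnabla_frame modular_cocycleMn.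
pose g : C := s (frame_volume algebroid_coord) E.
have sE : s = g *: Qframe := QsectionE s.
have g0 p : g p != 0.
  have [w [X]] := s0 p; rewrite sE lmapZE altZE.
  by apply: contraNneq => gp; rewrite -[_ p]/(g p * _) gp mul0r.
have [l gl] := exists_ln_abs g0.
apply/cohomology_class_eq; exists l => al; apply: (smoothFun_mulI g0).
have := sth al; rewrite sE Qnabla_scale Qnabla_frame !scalerA -scalerDl.
move=> /(Qsection_scale_inj Qframe1) h.
by rewrite mulrBr -gl modular_cocycleMn [g * th al]mulrC -h; ring.
Qed.

Lemma cohomology_classMn (N : cocycle1 A) k :
  cohomology_class (N *+ k.+1) = cohomology_class N *+ k.+1.
Proof.
by elim: k => [|k IH] //; rewrite [in LHS]mulrS cohomology_classD IH -mulrS.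
Qed.

End NambuModularClasses.

Theorem theorem5p3 (R : realType) (n : nat) (M : smoothManifold R n.+1)
    (m_ge3 : (3 <= n.+1)%N) (M_par : parallelizable M)
    (P : multivector M n.+1) (P_neq0 : P != 0) :
  (exists A : lieAlgebroid (diffForm M n), is_nambu_algebroid P A) /\
  (forall A : lieAlgebroid (diffForm M n), is_nambu_algebroid P A ->
     exists cA cP : H1 A,
       [/\ forall c : H1 A, is_ELW_modular_class n.+1 c <-> c = cA,
           forall c : H1 A, is_nambu_modular_class P c <-> c = cP
         & cA = cP *+ n.+1]).
Proof.
have [E [e Ee]] := parallelizable_frame M_par.
split=> [|A nambuA]; first exact: nambu_algebroid_exists Ee P.
exists (cohomology_class (modular_cocycle Ee nambuA *+ n.+1)).
exists (cohomology_class (modular_cocycle Ee nambuA)); split.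
- exact: ELW_modular_class.
- exact: nambu_modular_class.
- exact: cohomology_classMn.
Qed.
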